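(* Let $c \in [1/4,2]$. Then $c$ is the threshold for diameter 2 for some family of finite groups $(G_k)$ if and only if $c \in [1/4,4/3] \cup \{\frac{4n}{3n-1} : n \in \mathbb{N}\}$, where $\mathbb{N}$ denotes the positive integers.
   Context: For a finite group $G$ and a subset $S \subseteq G$, the Cayley graph $\Gamma(G;S)$ has vertex set $G$ and an edge between distinct $g,h$ if and only if $hg^{-1} \in S$ or $gh^{-1} \in S$ (loops and multiple edges are ignored). The random model $\mathcal{G}(G,p)$ is the probability space of graphs $\Gamma(G;S)$ where each element of $G$ is put in $S$ independently with probability $p$. The diameter of a disconnected graph is taken to be infinite. Let $(G_k)$ be a family of finite groups of orders $n_k$ with $n_k \to \infty$. A real $c>0$ is the threshold for diameter 2 for $(G_k)$ if for every $\varepsilon>0$, with probability tending to $1$ as $k\to\infty$, $\Gamma \in \mathcal{G}(G_k,p)$ has diameter greater than 2 if $p \leqslant \sqrt{(c-\varepsilon)\frac{\log n_k}{n_k}}$ and has diameter at most 2 if $p \geqslant \sqrt{(c+\varepsilon)\frac{\log n_k}{n_k}}$. *)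

(* Defs.v *)
From HB Require Import structures.
From mathcomp Require Import all_boot all_order all_algebra all_fingroup.
From mathcomp Require Import all_classical all_reals all_analysis.
Import Order.TTheory GRing.Theory Num.Theory.
Import numFieldNormedType.Exports.

Set Implicit Arguments.
Unset Strict Implicit.
Unset Printing Implicit Defensive.

Local Open Scope classical_set_scope.
Local Open Scope ring_scope.

Definition cayley (gT : finGroupType) (S : {set gT}) : rel gT :=
  fun g h => (g != h) && ((h * g^-1 \in S)%g || (g * h^-1 \in S)%g).

(* The infimum of the empty set is +oo, so vertices in different components
   are at distance +oo. *)
Definition gdist (R : realType) (T : finType) (e : rel T) (x y : T) : \bar R :=
  ereal_inf [set ((size s)%:R)%:E | s in [set s | path e x s /\ last x s = y]].

Definition diameter (R : realType) (T : finType) (e : rel T) : \bar R :=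
  ereal_sup [set gdist R e xy.1 xy.2 | xy in [set: T * T]].

(* Probability that the random subset S of T satisfies A, when each element of
   T is put in S independently with probability p. *)
Definition subset_prob (R : realType) (T : finType) (p : R)
    (A : pred {set T}) : R :=
  \sum_(S : {set T} | A S) \prod_(x : T) (if x \in S then p else 1 - p).

(* sqrt (a log n / n), with n the order of the group; Num.sqrt is 0 on negative
   reals. *)
Definition threshold_rate (R : realType) (gT : finGroupType) (a : R) : R :=
  Num.sqrt (a * (ln (#|gT|%:R) / #|gT|%:R)).

(* The bounds on p are only required for large k: for small k the rate
   may exceed 1, and then no probability satisfies the second one. *)
Definition is_diam2_threshold (R : realType) (G : nat -> finGroupType)
    (c : R) : Prop :=
  0 < c /\
  forall eps : R, 0 < eps ->
  forall p : nat -> R, (forall k, 0 <= p k <= 1) ->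
    ((\forall k \near \oo, p k <= threshold_rate (G k) (c - eps)) ->
      subset_prob (p k)
        (fun S : {set G k} => (2%:E < diameter R (cayley S))%E)
        @[k --> \oo] --> (1 : R)) /\
    ((\forall k \near \oo, threshold_rate (G k) (c + eps) <= p k) ->
      subset_prob (p k)
        (fun S : {set G k} => (diameter R (cayley S) <= 2%:E)%E)
        @[k --> \oo] --> (1 : R)).

(* Main.v *)
(** With [p^2 = a (ln n) / n], the probability that [x] is not a product of two
    elements of the connection set is at most [n^(- a D(x) / (2 n))] up to a
    factor tending to 1, where [D(x)] is the sum of the degrees of the graph on the
    group in which [y] and [z] are adjacent when [x] is a product of [y^(+-1)]
    and [z^(+-1)], in some order. One has [D(x) / (2 n) >= 3/4] unless [x] is a
    central involution, in which case [D(x) / (2 n) = 1 - i / (2 n)] with [i] the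
    number of solutions of [y^2 = 1]; for these [x] a second moment argument
    shows that the first moment bound is sharp. A threshold above 4/3 thus
    forces [i > n / 2]. Counting involutions in the cosets of a maximal
    elementary abelian 2-subgroup then shows that [n = r (2 i - n)] for an
    integer [r], so that [1 - i / (2 n) = (3 r - 1) / (4 r)], and that the center
    has index bounded in terms of [r]. Conversely, generalized dihedral groups
    realize [4 r / (3 r - 1)] and the interval [1, 4/3], and direct products of
    elementary abelian 2-groups with Heisenberg groups realize [1/4, 1]. *)

From HB Require Import structures.
Require Import Defs.
From mathcomp Require Import all_boot all_order all_algebra all_fingroup pgroup cyclic.
From mathcomp Require Import all_classical all_reals all_analysis.
From mathcomp Require Import ring lra zify.
Import Order.TTheory GRing.Theory Num.Theory.
Import numFieldNormedType.Exports.
Set Implicit Arguments.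
Unset Strict Implicit.
Unset Printing Implicit Defensive.
Local Open Scope ring_scope.

(** * Random subsets *)

(** Let [Z] be the set of central [x] with [x^2 = 1], and [lam = 1 - i / (2 n)]. The bounded index
    of the center is used twice. It gives [ln |Z| = ln n - O(1)], so that the expected number of
    uncovered [x] in [Z], about [|Z| n^(- a lam)], passes from large to small at [a = 1 / lam]. It
    also bounds the number of squares, since every square has at least [|Z|] square roots; this is
    what the second moment needs, because the events for [x] and [x'] interact only when [x x'] is a
    square. All the graphs have degree at most 8, or 16 for the union of two, and [p^2 n] has order
    [ln n]. Dependence between edges therefore costs a factor [exp(O(p^3 n))], which tends to 1, and
    exposing the vertices one at a time is precise enough. In the families, a class of [n^s]
    elements with [D(x) / (2 n)] near [u] is covered once [a > s / u]. The sizes are tuned so that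
    central involutions have the largest [s / u]. Degree 8 means [u <= 4], and the class of almost
    all elements, with [s = 1] and [u = 4], accounts for the endpoint 1/4. *)

Section RandomSubset.
Variables (R : realType) (T : finType).
Implicit Types (p : R) (A B : pred {set T}) (S W : {set T}).

Let weight p S : R := \prod_(x : T) (if x \in S then p else 1 - p).

Let weight_ge0 p S : 0 <= p <= 1 -> 0 <= weight p S.
Proof.
by case/andP=> p0 p1; apply: prodr_ge0 => x _; case: ifP; rewrite ?subr_ge0.
Qed.

Lemma subset_prob_ge0 p A : 0 <= p <= 1 -> 0 <= subset_prob p A.
Proof. by move=> p01; apply: sumr_ge0 => S _; exact: weight_ge0. Qed.

Lemma subset_prob_mono p A B : 0 <= p <= 1 -> (forall S, A S -> B S) ->
  subset_prob p A <= subset_prob p B.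
Proof.
move=> p01 AB; rewrite /subset_prob [leRHS]big_mkcond [leLHS]big_mkcond /=.
apply: ler_sum => S _; case: ifPn => [/AB -> //|_]; case: ifP => // _.
exact: weight_ge0.
Qed.

Lemma eq_subset_prob p A B : A =1 B -> subset_prob p A = subset_prob p B.
Proof. by move=> AB; apply: eq_bigl. Qed.

Lemma subset_prob_total p : subset_prob p (fun _ : {set T} => true) = 1.
Proof.
transitivity (\prod_(x : T) (p + (1 - p))).
  by rewrite bigA_distr.
by rewrite big1 // => x _; rewrite addrC subrK.
Qed.

Lemma subset_probC p A : subset_prob p A = 1 - subset_prob p (predC A).
Proof. by rewrite -(subset_prob_total p) /subset_prob [in RHS](bigID A) /= addrK. Qed.

Lemma subset_prob_disj p A B :
  subset_prob p A = subset_prob p (predI A B) + subset_prob p (predI A (predC B)).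
Proof. by rewrite /subset_prob (bigID B). Qed.

Lemma subset_prob_le1 p A : 0 <= p <= 1 -> subset_prob p A <= 1.
Proof.
by move=> p01; rewrite -(subset_prob_total p); exact: subset_prob_mono.
Qed.

Lemma subset_prob_union p (I : finType) (Q : pred I) (A : I -> pred {set T}) :
  0 <= p <= 1 ->
  subset_prob p (fun S => [exists i, Q i && A i S]) <=
    \sum_(i | Q i) subset_prob p (A i).
Proof.
move=> p01; rewrite /subset_prob big_mkcond /=.
under [leRHS]eq_bigr do rewrite big_mkcond /=.
rewrite exchange_big /=; apply: ler_sum => S _.
have pos i : 0 <= (if A i S then weight p S else 0).
  by case: ifP => // _; exact: weight_ge0.
case: ifPn => [/existsP[i /andP[Qi Ai]]|_]; last exact: sumr_ge0.
by rewrite (bigD1 i) //= Ai lerDl; apply: sumr_ge0.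
Qed.

Lemma subset_prob_cond p v A : subset_prob p A =
  p * subset_prob p (fun S => A (v |: S)) +
  (1 - p) * subset_prob p (fun S => A (S :\ v)).
Proof.
pose w S : R := \prod_(x | x != v) (if x \in S then p else 1 - p).
have wE S : weight p S = (if v \in S then p else 1 - p) * w S.
  by rewrite /weight (bigD1 v).
have wU S : w (v |: S) = w S.
  by apply: eq_bigr => x xv; rewrite !inE (negPf xv).
have split F : \sum_(S : {set T}) F S * weight p S =
    p * (\sum_(S : {set T} | v \notin S) F (v |: S) * w S) +
    (1 - p) * (\sum_(S : {set T} | v \notin S) F S * w S).
  rewrite (bigID (fun S : {set T} => v \in S)) /=; congr (_ + _).
    rewrite (reindex_onto (fun S : {set T} => v |: S) (fun S : {set T} => S :\ v)) /=; last first.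
      by move=> S vS; rewrite finset.setD1K.
    rewrite mulr_sumr; apply: eq_big => [S|S].
      rewrite setU11 /=; apply/eqP/idP => [<-|vS]; first by rewrite !inE eqxx.
      by rewrite setU1K.
    by rewrite wE setU11 wU => _; rewrite mulrCA.
  by rewrite mulr_sumr; apply: eq_bigr => S /negPf vS; rewrite wE vS mulrCA.
have probE B : subset_prob p B = \sum_(S : {set T}) (B S)%:R * weight p S.
  rewrite /subset_prob big_mkcond; apply: eq_bigr => S _.
  by case: (B S); rewrite ?mul1r ?mul0r.
rewrite !probE !split.
have -> : \sum_(S : {set T} | v \notin S) (A (v |: (v |: S)))%:R * w S =
    \sum_(S : {set T} | v \notin S) (A (v |: S))%:R * w S.
  by apply: eq_bigr => S _; rewrite finset.setUA finset.setUid.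
have -> : \sum_(S : {set T} | v \notin S) (A ((v |: S) :\ v))%:R * w S =
    \sum_(S : {set T} | v \notin S) (A S)%:R * w S.
  by apply: eq_bigr => S vS; rewrite setU1K.
have -> : \sum_(S : {set T} | v \notin S) (A (S :\ v))%:R * w S =
    \sum_(S : {set T} | v \notin S) (A S)%:R * w S.
  apply: eq_bigr => S vS; congr ((A _)%:R * _).
  by apply/setP => x; rewrite !inE; case: eqP => [->|//]; rewrite (negPf vS).
by ring.
Qed.

(* A random set of density [p] is obtained from one of density [q] by keeping
   each of its points with probability [p / q]; [g] is the joint weight. *)
Lemma subset_prob_upset p q A : 0 <= p -> p <= q -> q <= 1 ->
  (forall S S', S \subset S' -> A S -> A S') ->
  subset_prob p A <= subset_prob q A.
Proof.
move=> p0 pq q1 upA.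
pose g (b b' : bool) : R :=
  if b then (if b' then p else 0) else (if b' then q - p else 1 - q).
have g0 b b' : 0 <= g b b' by case: b; case: b'; rewrite /g ?subr_ge0.
have pE S : weight p S = \sum_(S' : {set T}) \prod_x g (x \in S) (x \in S').
  transitivity (\prod_x (g (x \in S) true + g (x \in S) false)).
    by apply: eq_bigr => x _; rewrite /g; case: ifP => _; ring.
  rewrite bigA_distr /=; apply: eq_bigr => S' _; apply: eq_bigr => x _.
  by case: (x \in S').
have qE S' : weight q S' = \sum_(S : {set T}) \prod_x g (x \in S) (x \in S').
  transitivity (\prod_x (g true (x \in S') + g false (x \in S'))).
    by apply: eq_bigr => x _; rewrite /g; case: ifP => _; ring.
  rewrite bigA_distr /=; apply: eq_bigr => S _; apply: eq_bigr => x _.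
  by case: (x \in S).
rewrite /subset_prob.
under eq_bigr do rewrite -/(weight p _) pE.
under [leRHS]eq_bigr do rewrite -/(weight q _) qE.
rewrite exchange_big /= [leRHS]big_mkcond /=; apply: ler_sum => S' _.
have g_ge0 S : 0 <= \prod_x g (x \in S) (x \in S') by apply: prodr_ge0.
case: ifPn => AS'.
  by rewrite [leRHS](bigID A) /= lerDl; apply: sumr_ge0.
rewrite big1 // => S AS; have /subsetPn[x xS xS'] : ~~ (S \subset S').
  by apply: contraNN AS' => SS'; exact: upA AS.
by rewrite (bigD1 x) //= /g xS (negPf xS') mul0r.
Qed.

End RandomSubset.

(** * Independent sets of sparse random sets *)

Section IndependentSets.
Variables (R : realType) (T : finType) (e : rel T).

(** The case [y = z] is included, so a vertex with a loop lies in no independent set. This is wanted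
    for [prodrel x], where a loop at [y] means that [y] and its inverse alone already yield [x]. *)
Definition indep (S : {set T}) := [forall y in S, forall z in S, ~~ e y z].

Lemma indepP (S : {set T}) :
  reflect (forall y z, y \in S -> z \in S -> ~~ e y z) (indep S).
Proof.
apply: (iffP forall_inP) => [h y z yS zS|h y yS].
  by move/forall_inP: (h y yS); apply.
by apply/forall_inP => z zS; exact: h.
Qed.

Lemma indepS (S W : {set T}) : S \subset W -> indep W -> indep S.
Proof.
by move=> /fintype.subsetP SW /indepP h; apply/indepP => y z /SW yW /SW zW; exact: h.
Qed.

Definition nbrs (W : {set T}) (y : T) := [set z in W | e y z]%SET.
(** Ordered pairs are counted: an edge contributes 2 and a loop contributes 1. *)
Definition degsum (W : {set T}) := (\sum_(y in W) #|nbrs W y|)%N.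

Variable p : R.
Hypothesis p01 : 0 <= p <= 1.

Let p0 : 0 <= p. Proof. by case/andP: p01. Qed.
Let p1 : 0 <= 1 - p. Proof. by case/andP: p01; rewrite subr_ge0. Qed.

(** Membership of the points of [N] is independent of [S :\: N]; conditioning peels off one point of
    [N] at a time. *)
Lemma prob_avoid (N : {set T}) (A : pred {set T}) :
  subset_prob p (fun S => (S :&: N == finset.set0) && A (S :\: N)) =
  (1 - p) ^+ #|N| * subset_prob p (fun S => A (S :\: N)).
Proof.
have [m] := ubnP #|N|; elim: m N A => // m IH N A; rewrite ltnS => cNm.
have [->|[v vN]] := set_0Vmem N.
  rewrite cards0 expr0 mul1r; apply: eq_subset_prob => S.
  by rewrite finset.setI0 eqxx.
pose N' := N :\ v; have NE : N = v |: N' by rewrite finset.setD1K.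
have cN : #|N| = #|N'|.+1 by rewrite (cardsD1 v N) vN.
rewrite (subset_prob_cond p v) [X in p * X + _](_ : _ = 0) ?mulr0 ?add0r; last first.
  rewrite /subset_prob big1 // => S /andP[/eqP/setP/(_ v)].
  by rewrite !inE eqxx vN.
pose A' S := A (S :\ v).
have D1 (S : {set T}) : (S :\ v) :\: N = (S :\: N') :\ v.
  by apply/setP => x; rewrite !inE; case: (x == v); rewrite ?andbF.
have D2 (S : {set T}) : S :\: N = (S :\: N') :\ v.
  by apply/setP => x; rewrite !inE; case: eqP => // ->; rewrite vN.
have IHN := IH N' A'; rewrite -cN cNm in IHN; have {}IHN := IHN isT.
rewrite cN exprS -mulrA; congr (_ * _).
transitivity (subset_prob p (fun S => (S :&: N' == finset.set0) && A' (S :\: N'))).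
  apply: eq_subset_prob => S; rewrite D1; congr (_ && _); congr (_ == _).
  by apply/setP => x; rewrite NE !inE; case: (x == v); rewrite ?andbF.
by rewrite IHN; congr (_ * _); apply: eq_subset_prob => S; rewrite /A' -D2.
Qed.

Let I (W : {set T}) := subset_prob p (fun S => indep (S :&: W)).

Lemma prob_mem_and (w : T) (A : pred {set T}) :
  subset_prob p (fun S => (w \in S) && A S) =
  p * subset_prob p (fun S => A (w |: S)).
Proof.
rewrite (subset_prob_cond p w) [X in _ + _ * X](_ : _ = 0) ?mulr0 ?addr0.
  by congr (_ * _); apply: eq_subset_prob => S; rewrite setU11.
by rewrite /subset_prob big1 // => S /andP[]; rewrite !inE eqxx.
Qed.

(** Negative correlation of an increasing and a decreasing event: adding [w] to [S] can only destroy
    independence. *)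
Lemma prob_mem_indep (w : T) (W : {set T}) :
  subset_prob p (fun S => (w \in S) && indep (S :&: W)) <= p * I W.
Proof.
rewrite prob_mem_and ler_wpM2l // /I [leRHS](subset_prob_cond p w).
set a := subset_prob _ _; set b := subset_prob _ _.
have ab : a <= b.
  apply: subset_prob_mono => // S; apply: indepS; apply: finset.setSI.
  by apply/fintype.subsetP => x; rewrite !inE => /andP[_ ->]; rewrite orbT.
have : (1 - p) * a <= (1 - p) * b by exact: ler_wpM2l.
by rewrite mulrBl mul1r; lra.
Qed.

Lemma indep_prob_anti (W W' : {set T}) : W \subset W' -> I W' <= I W.
Proof.
by move=> WW'; apply: subset_prob_mono => // S; apply/indepS/finset.setIS.
Qed.

Hypothesis e_sym : symmetric e.
Variable Delta : nat.
Hypothesis e_deg : forall y, (#|[set z | e y z]%SET| <= Delta)%N.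

Lemma card_nbrs_le W y : (#|nbrs W y| <= Delta)%N.
Proof.
apply: leq_trans (e_deg y); apply: subset_leq_card.
by apply/fintype.subsetP => z; rewrite !inE => /andP[].
Qed.

(** If [S] is independent on [W :\: N] but not on [W], it contains both ends of an edge meeting [N].
    There are at most [Delta ^ 2] such edges, and each is contained in [S] with probability at most
    [p ^ 2], even jointly with independence on [W :\: N]. *)
Lemma indep_prob_remove (W N : {set T}) : (#|N| <= Delta)%N ->
  (forall u, u \in N -> ~~ e u u) ->
  I (W :\: N) * (1 - Delta%:R ^+ 2 * p ^+ 2) <= I W.
Proof.
move=> Nd Nl; rewrite mulrBr mulr1 lerBlDr -lerBlDl.
pose J := I (W :\: N); have J0 : 0 <= J by exact: subset_prob_ge0.
pose Q (uw : T * T) := (uw.1 \in N) && e uw.1 uw.2.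
pose A (uw : T * T) (S : {set T}) :=
  (uw.1 \in S) && ((uw.2 \in S) && indep (S :&: (W :\: N))).
apply: (@le_trans _ _ (subset_prob p (fun S => [exists uw, Q uw && A uw S]))).
  rewrite lerBlDl /I [leLHS](subset_prob_disj p _ (fun S => indep (S :&: W))).
  apply: lerD; apply: subset_prob_mono => // S /= /andP[h1 h2] //.
  have: ~~ [forall y in S :&: W, forall z in S :&: W, ~~ e y z] by [].
  case/forall_inPn => y yS /forall_inPn[z zS]; rewrite negbK => eyz.
  have sN u w : u \in S -> w \in S -> e u w -> u \in N ->
      [exists uw, Q uw && A uw S].
    by move=> uS wS euw uN; apply/existsP; exists (u, w); rewrite /Q /A /= uN euw uS wS.
  move: yS zS; rewrite !inE => /andP[yS yW] /andP[zS zW].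
  have [yN|yN] := boolP (y \in N); first exact: sN eyz yN.
  have [zN|zN] := boolP (z \in N); first by apply: (sN z y); rewrite // e_sym.
  by move/indepP: h1 => /(_ y z); rewrite !inE yS yW yN zS zW zN eyz => /(_ isT isT).
apply: le_trans (subset_prob_union Q A p01) _.
apply: (@le_trans _ _ (\sum_(uw | Q uw) p ^+ 2 * J)).
  apply: ler_sum => -[u w] /andP[/= uN euw].
  rewrite /A /= prob_mem_and expr2 -mulrA ler_wpM2l //.
  apply: le_trans (prob_mem_indep w _); apply: subset_prob_mono => // S.
  (* [N] carries no loop, so the two ends are distinct and each costs its own factor [p]. *)
  have uw : w != u by apply: contraTneq euw => ->; exact: Nl.
  rewrite !inE (negPf uw) /= => /andP[-> /=]; apply: indepS; apply: finset.setSI.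
  exact: finset.subsetUr.
rewrite sumr_const -[leLHS]mulr_natl [leRHS]mulrC -/J mulrA; set q := #|_|.
rewrite ler_wpM2r //.
rewrite ler_wpM2r ?exprn_ge0 // -natrX ler_nat.
have -> : q = (\sum_(u in N) #|[set w | e u w]%SET|)%N.
  rewrite /q -sum1_card (eq_bigl (fun uw : T * T => (uw.1 \in N) && e uw.1 uw.2)) //.
  rewrite -(pair_big_dep (fun u => u \in N) e (fun _ _ => 1%N)) /=.
  apply: eq_bigr => u _; rewrite -sum1_card; apply: eq_bigl => w.
  by rewrite inE.
apply: (@leq_trans (\sum_(u in N) Delta)); first by apply: leq_sum => u _.
by rewrite sum_nat_const expnS expn1 leq_mul2r Nd orbT.
Qed.

(** Conditioning on [v]: if [v] is chosen, all its neighbours in [W] must be avoided, and only the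
    rest of [W] still has to be independent. *)
Lemma indep_prob_add (W : {set T}) (v : T) : v \notin W -> ~~ e v v ->
  I (v |: W) = (1 - p) * I W +
    p * ((1 - p) ^+ #|nbrs W v| * I (W :\: nbrs W v)).
Proof.
move=> vW vl; rewrite addrC /I (subset_prob_cond p v); congr (_ * _ + _ * _).
  pose N := nbrs W v.
  transitivity (subset_prob p (fun S => (S :&: N == finset.set0) &&
      indep ((S :\: N) :&: W))).
    apply: eq_subset_prob => S.
    apply/indepP/andP => [h|[/eqP/setP SN /indepP h] y z].
      split; last first.
        apply/indepP => y z; rewrite !inE => /andP[/andP[_ yS] yW] /andP[/andP[_ zS] zW].
        by apply: h; rewrite !inE ?yS ?yW ?zS ?zW !orbT.
      apply/eqP/setP => z; rewrite !inE; apply/negP => /andP[zS /andP[zW evz]].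
      by move: (h v z); rewrite !inE eqxx zS zW evz !orbT => /(_ isT isT).
    have nN u : u \in S -> u \in W -> (u \notin N) && ~~ e v u.
      by move=> uS uW; move: (SN u); rewrite !inE uS uW /= => ->.
    have ev u : (u \in (v |: S) :&: (v |: W)) -> ~~ e v u.
      rewrite !inE; case: eqP => [-> //|_] /= /andP[uS uW].
      by case/andP: (nN u uS uW).
    move=> yI zI; have [->|yv] := eqVneq y v; first exact: ev.
    have [->|zv] := eqVneq z v; first by rewrite e_sym ev.
    move: yI zI; rewrite !inE (negPf yv) (negPf zv) /= => /andP[yS yW] /andP[zS zW].
    apply: h; rewrite !inE ?yS ?yW ?zS ?zW ?andbT.
      by case/andP: (nN y yS yW); rewrite !inE yW.
    by case/andP: (nN z zS zW); rewrite !inE zW.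
  rewrite (prob_avoid N (fun S => indep (S :&: W))); congr (_ * _).
  apply: eq_subset_prob => S; congr indep.
  by apply/setP => x; rewrite !inE; case: (x \in S); rewrite ?andbF ?andbT.
apply: eq_subset_prob => S; congr indep; apply/setP => x; rewrite !inE.
by have [->|] := eqVneq x v; rewrite //= (negPf vW) !andbF.
Qed.

Lemma degsum_add (W : {set T}) (v : T) : v \notin W -> ~~ e v v ->
  degsum (v |: W) = (degsum W + 2 * #|nbrs W v|)%N.
Proof.
move=> vW vl; rewrite /degsum big_setU1 //=.
have -> : nbrs (v |: W) v = nbrs W v.
  by apply/setP => x; rewrite !inE; case: eqP => // ->; rewrite (negPf vl) (negPf vW).
suff -> : (\sum_(y in W) #|nbrs (v |: W) y| =
    \sum_(y in W) #|nbrs W y| + #|nbrs W v|)%N by lia.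
have -> : #|nbrs W v| = (\sum_(y in W) e y v)%N.
  rewrite -sum1_card big_mkcond [RHS]big_mkcond; apply: eq_bigr => y _.
  by rewrite inE e_sym; case: (y \in W); case: (e v y).
rewrite -big_split; apply: eq_bigr => y yW /=; rewrite addnC.
have [eyv|eyv] := boolP (e y v); last first.
  congr #|pred_of_set _|; apply/setP => x; rewrite !inE.
  by case: eqP => // ->; rewrite (negPf eyv) !andbF.
have -> : nbrs (v |: W) y = v |: nbrs W y.
  by apply/setP => x; rewrite !inE; case: eqP => // ->; rewrite eyv.
by rewrite cardsU1 !inE (negPf vW).
Qed.

(** A new vertex with [d] neighbours among the old ones multiplies the probability by at most
    [1 - d p^2 + 3 Delta^2 p^3], and the numbers [d] add up to half the degree sum. In the constant
    3, one unit comes from expanding [(1 - p) ^+ d] and two from the neighbours deleted by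
    [indep_prob_add]. *)
Lemma indep_prob_le_loopless (W : {set T}) : Delta%:R * p <= 1 / 2 ->
  (forall v, v \in W -> ~~ e v v) ->
  I W <= expR (- (p ^+ 2 * (degsum W)%:R / 2) + 3 * Delta%:R ^+ 2 * p ^+ 3 * #|W|%:R).
Proof.
move=> dp; have [m] := ubnP #|W|; elim: m W => // m IH W; rewrite ltnS => cWm Wl.
have [->|[v vW]] := set_0Vmem W.
  rewrite cards0 /degsum big_set0 mulr0 mul0r oppr0 mulr0 addr0 expR0.
  exact: subset_prob_le1.
pose W' := W :\ v; have WE : W = v |: W' by rewrite finset.setD1K.
have vW' : v \notin W' by rewrite !inE eqxx.
have cW : #|W| = #|W'|.+1 by rewrite (cardsD1 v W) vW.
have W'l u : u \in W' -> ~~ e u u by rewrite inE => /andP[_]; exact: Wl.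
have cW'm : (#|W'| < m)%N by rewrite -cW.
have IHW := IH W' cW'm W'l.
rewrite WE indep_prob_add ?Wl // degsum_add ?Wl //.
set N := nbrs W' v; set d := #|N|.
have dD : (d <= Delta)%N by exact: card_nbrs_le.
have rem := @indep_prob_remove W' N dD _.
have {}rem : I (W' :\: N) * (1 - Delta%:R ^+ 2 * p ^+ 2) <= I W'.
  by apply: rem => u; rewrite inE => /andP[uW _]; exact: W'l.
set J := I (W' :\: N) in rem *.
have J0 : 0 <= J by exact: subset_prob_ge0.
have I0 : 0 <= I W' by exact: subset_prob_ge0.
set D : R := Delta%:R in dp rem *.
have D0 : 0 <= D by exact: ler0n.
have dDR : d%:R <= D by rewrite ler_nat.
have d0 : 0 <= d%:R :> R by exact: ler0n.
(* This inverts [indep_prob_remove] by [1 / (1 - x) <= 1 + 2 x], valid since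
   [x = (D p)^2 <= 1/4]. *)
have JI : J <= I W' * (1 + 2 * D ^+ 2 * p ^+ 2).
  have : (D * p) ^+ 2 <= 1 / 4.
    have : 0 <= D * p by exact: mulr_ge0.
    by move: dp; set x := D * p; nra.
  rewrite exprMn -mulrA; set x := D ^+ 2 * p ^+ 2 in rem *.
  have x0 : 0 <= x by rewrite mulr_ge0 ?exprn_ge0.
  move=> x4; have h1 : 0 <= 1 + 2 * x by lra.
  have h2 : 0 <= 1 - 2 * x by lra.
  have := ler_wpM2r h1 rem; have := mulr_ge0 (mulr_ge0 J0 x0) h2.
  by rewrite !(mulrDr, mulrDl, mulrBr, mulrBl); lra.
have pw1 : (1 - p) ^+ d <= 1 by apply: exprn_ile1 => //; rewrite gerBl.
have pw2 : (1 - p) ^+ d <= 1 - d%:R * p + d%:R ^+ 2 * p ^+ 2.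
  elim: d {dD dDR d0 pw1} => [|d IHd]; first by rewrite expr0; nra.
  rewrite exprS; have := ler_wpM2l p1 IHd; rewrite -natr1.
  have : 0 <= d%:R :> R by exact: ler0n.
  set t : R := d%:R => t0 /le_trans; apply.
  have : 0 <= t ^+ 2 * p ^+ 3 by rewrite mulr_ge0 ?exprn_ge0.
  have : 0 <= (t + 1) * p ^+ 2 by rewrite mulr_ge0 ?exprn_ge0 //; lra.
  by rewrite !exprS !expr0 ?mulr1 => ? ?; nra.
have pw0 : 0 <= (1 - p) ^+ d by exact: exprn_ge0.
have step : (1 - p) * I W' + p * ((1 - p) ^+ d * J) <=
    I W' * (1 - d%:R * p ^+ 2 + 3 * D ^+ 2 * p ^+ 3).
  have h1 : (1 - p) ^+ d * J <=
      I W' * ((1 - p) ^+ d + 2 * D ^+ 2 * p ^+ 2).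
    apply: (@le_trans _ _ ((1 - p) ^+ d * (I W' * (1 + 2 * D ^+ 2 * p ^+ 2)))).
      exact: ler_wpM2l.
    rewrite mulrCA ler_wpM2l // mulrDr mulr1 lerD2l -[leRHS]mul1r ler_wpM2r //.
    by rewrite !mulr_ge0 ?exprn_ge0.
  have h2 : (1 - p) ^+ d + 2 * D ^+ 2 * p ^+ 2 <= 1 - d%:R * p + 3 * D ^+ 2 * p ^+ 2.
    have : d%:R ^+ 2 * p ^+ 2 <= D ^+ 2 * p ^+ 2.
      by rewrite ler_wpM2r ?exprn_ge0 // lerXn2r ?nnegrE.
    by lra.
  have h3 := le_trans h1 (ler_wpM2l I0 h2).
  have h4 := ler_wpM2l p0 h3.
  apply: (@le_trans _ _ ((1 - p) * I W' +
    p * (I W' * (1 - d%:R * p + 3 * D ^+ 2 * p ^+ 2)))); first by rewrite lerD2l.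
  by lra.
apply: le_trans step _.
apply: (@le_trans _ _ (I W' * expR (- (d%:R * p ^+ 2) + 3 * D ^+ 2 * p ^+ 3))).
  by rewrite ler_wpM2l //; apply: le_trans (expR_ge1Dx _); lra.
apply: le_trans (ler_wpM2r (expR_ge0 _) IHW) _.
rewrite -expRD ler_expR cardsU1 vW' natrD natrM natrD -/D mulr1n.
by lra.
Qed.

(** Loops only help. A looped vertex must be avoided, at the price [1 - p <= exp(- p^2 Delta)],
    whereas discarding it lowers the degree sum by at most [2 Delta], worth the same [p^2 Delta] in
    the exponent. *)
Lemma indep_prob_le : Delta%:R * p <= 1 / 2 ->
  subset_prob p indep <=
  expR (- (p ^+ 2 * (degsum [set: T]%SET)%:R / 2) + 3 * Delta%:R ^+ 2 * p ^+ 3 * #|T|%:R).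
Proof.
move=> dp; pose L := [set v | e v v]%SET; pose V := ~: L.
have Vl v : v \in V -> ~~ e v v by rewrite !inE.
have le1 : subset_prob p indep <= (1 - p) ^+ #|L| * I V.
  rewrite /I.
  have -> : subset_prob p (fun S => indep (S :&: V)) = subset_prob p (fun S => indep (S :\: L)).
    by apply: eq_subset_prob => S; rewrite finset.setDE.
  rewrite -(prob_avoid L indep); apply: subset_prob_mono => // S Si.
  apply/andP; split; last by apply: indepS Si; apply: finset.subsetDl.
  apply/eqP/setP => v; rewrite !inE; apply/negP => /andP[vS].
  by apply/negP; move/indepP: Si; apply.
apply: (le_trans le1).
have IV := indep_prob_le_loopless dp Vl.
have le2 : (1 - p) ^+ #|L| <= expR (- (p ^+ 2 * Delta%:R * #|L|%:R)).
  apply: (@le_trans _ _ (expR (- p) ^+ #|L|)).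
    by rewrite lerXn2r ?nnegrE ?expR_ge0 //; apply: le_trans (expR_ge1Dx _); lra.
  rewrite -expRM_natl ler_expR mulrN lerN2 [leRHS]mulrC ler_wpM2r ?ler0n // expr2 -mulrA -[leRHS]mulr1 ler_wpM2l //.
  by rewrite mulrC; lra.
have I0 : 0 <= I V by exact: subset_prob_ge0.
have q0 : 0 <= (1 - p) ^+ #|L| by exact: exprn_ge0.
apply: le_trans (ler_pM q0 I0 le2 IV) _.
rewrite -expRD ler_expR.
have dg : (degsum [set: T]%SET <= degsum V + 2 * (Delta * #|L|))%N.
  rewrite /degsum (bigID (fun v => v \in V)) /=.
  have -> : (2 * (Delta * #|L|) = \sum_(v in L) Delta + \sum_(v in L) Delta)%N.
    by rewrite sum_nat_const; lia.
  rewrite addnA; apply: leq_add; last first.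
    rewrite (eq_bigl (fun v => v \in L)); last by move=> v; rewrite !inE negbK.
    by apply: leq_sum => v _; exact: card_nbrs_le.
  have -> : (\sum_(i in [set: T]%SET | i \in V) #|nbrs [set: T]%SET i| =
     \sum_(i in V) (#|nbrs V i| + #|nbrs L i|))%N.
    apply: eq_big => [i|i]; first by rewrite !inE.
    move=> _; rewrite -cardsUI [X in (_ + #|pred_of_set X|)%N](_ : _ = finset.set0).
      rewrite cards0 addn0; congr #|pred_of_set _|; apply/setP => z; rewrite !inE.
      by case: (e z z); rewrite /= ?orbF; case: (e i z).
    by apply/setP => z; rewrite !inE; case: (e z z); rewrite ?andbF.
  rewrite big_split leq_add2l /=.
  have cE i (X : {set T}) : #|nbrs X i| = (\sum_(z in X) e i z)%N.
    rewrite -sum1_card big_mkcond [RHS]big_mkcond; apply: eq_bigr => z _.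
    by rewrite inE; case: (z \in X); case: (e i z).
  under eq_bigr do rewrite cE; rewrite exchange_big /=; apply: leq_sum => z _.
  under eq_bigr do rewrite e_sym; rewrite -cE; exact: card_nbrs_le.
have dgR : (degsum [set: T]%SET)%:R <= (degsum V)%:R + 2 * (Delta%:R * #|L|%:R) :> R.
  by rewrite -!natrM -natrD ler_nat.
have cV : #|V|%:R <= #|T|%:R :> R by rewrite ler_nat max_card.
have pD : 0 <= 3 * Delta%:R ^+ 2 * p ^+ 3 :> R by rewrite !mulr_ge0 ?exprn_ge0.
have := ler_wpM2l pD cV; have p2 : 0 <= p ^+ 2 by exact: exprn_ge0.
have := ler_wpM2l p2 dgR; lra.
Qed.

(** Same one-vertex recursion as for the upper bound. Deleting neighbours now works in the right
    direction, so each new vertex costs a factor at least [1 - d p^2]. *)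
Lemma indep_prob_ge : Delta%:R * p ^+ 2 <= 1 / 2 -> (forall v, ~~ e v v) ->
  expR (- (p ^+ 2 * (degsum [set: T]%SET)%:R / 2) - 2 * Delta%:R ^+ 2 * p ^+ 4 * #|T|%:R)
  <= subset_prob p indep.
Proof.
move=> dp loopless.
suff IW (W : {set T}) :
    expR (- (p ^+ 2 * (degsum W)%:R / 2) - 2 * Delta%:R ^+ 2 * p ^+ 4 * #|W|%:R) <= I W.
  have := IW [set: T]%SET; rewrite cardsT => /le_trans; apply.
  by rewrite /I; under eq_subset_prob do rewrite finset.setIT.
have [m] := ubnP #|W|; elim: m W => // m IH W; rewrite ltnS => cWm.
have [->|[v vW]] := set_0Vmem W.
  rewrite cards0 /degsum big_set0 mulr0 mul0r oppr0 mulr0 subr0 expR0.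
  rewrite /I -(subset_prob_total T p) le_eqVlt; apply/orP; left; apply/eqP.
  apply: eq_subset_prob => S; symmetry.
  by apply/indepP => y z; rewrite finset.setI0 inE.
pose W' := W :\ v; have WE : W = v |: W' by rewrite finset.setD1K.
have vW' : v \notin W' by rewrite !inE eqxx.
have cW : #|W| = #|W'|.+1 by rewrite (cardsD1 v W) vW.
have cW'm : (#|W'| < m)%N by rewrite -cW.
have {}IH := IH W' cW'm.
rewrite WE indep_prob_add ?degsum_add // cardsU1 vW' natrD natrM natrD.
set N := nbrs W' v; set d := #|N|.
have dD : (d <= Delta)%N by exact: card_nbrs_le.
have JI : I W' <= I (W' :\: N) by apply: indep_prob_anti; exact: finset.subsetDl.
have I0 : 0 <= I W' by exact: subset_prob_ge0.
have pw : 1 - d%:R * p <= (1 - p) ^+ d.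
  elim: d {dD} => [|d IHd]; first by rewrite expr0; lra.
  rewrite exprS -natr1; apply: le_trans (ler_wpM2l p1 IHd).
  have : 0 <= d%:R * p ^+ 2 by rewrite mulr_ge0 ?exprn_ge0.
  by rewrite expr2; lra.
set t := d%:R * p ^+ 2.
have t0 : 0 <= t by rewrite mulr_ge0 ?exprn_ge0.
have tD : t <= Delta%:R * p ^+ 2 by rewrite ler_wpM2r ?exprn_ge0 // ler_nat.
have step : I W' * (1 - t) <= (1 - p) * I W' + p * ((1 - p) ^+ d * I (W' :\: N)).
  have h1 : (1 - d%:R * p) * I W' <= (1 - p) ^+ d * I (W' :\: N).
    apply: le_trans (ler_wpM2r I0 pw) _; apply: ler_wpM2l => //.
    exact: exprn_ge0.
  have := ler_wpM2l p0 h1; rewrite /t expr2; lra.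
apply: le_trans step.
(* Reason: [(1 - t) (1 + t + 2 t^2) = 1 + t^2 (1 - 2 t)], with [t <= 1/2]. *)
have ex : expR (- t - 2 * t ^+ 2) <= 1 - t.
  rewrite -opprD expRN -[leRHS]invrK lef_pV2 ?posrE ?expR_gt0 ?invr_gt0 //; last by lra.
  apply: le_trans (expR_ge1Dx _); rewrite -[leLHS]mul1r ler_pdivrMr; last by lra.
  have : 0 <= t ^+ 2 * (1 - 2 * t) by rewrite mulr_ge0 ?exprn_ge0 //; lra.
  by lra.
have t2 : t ^+ 2 <= Delta%:R ^+ 2 * p ^+ 4.
  by rewrite [p ^+ 4](exprM p 2 2) -exprMn lerXn2r ?nnegrE // (le_trans t0).
have h := ler_pM (expR_ge0 _) (expR_ge0 _) IH ex; apply: (le_trans _ h).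
rewrite -expRD ler_expR mulr1n; move: t2; rewrite /t; lra.
Qed.

(** Removing [x] from [S] preserves independence. The extra event [x \notin S] is needed because [x]
    in [S] would be adjacent to the identity. *)
Lemma indep_prob_avoid_ge (x : T) :
  (1 - p) * subset_prob p indep <= subset_prob p (fun S => (x \notin S) && indep S).
Proof.
rewrite [leRHS](subset_prob_cond p x); apply: le_trans (_ : (1 - p) *
  subset_prob p (fun S => (x \notin S :\ x) && indep (S :\ x)) <= _); last first.
  by rewrite lerDr mulr_ge0 // subset_prob_ge0.
rewrite ler_wpM2l //; apply: subset_prob_mono => // S Si.
by rewrite !inE eqxx /=; apply: indepS Si; exact: finset.subsetDl.
Qed.

End IndependentSets.

(** * Distance and products in Cayley graphs *)

Section Diameter.
Variables (R : realType) (T : finType) (e : rel T).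

Lemma diameter_le2P : reflect
  (forall x y, exists s, [/\ path e x s, last x s = y & (size s <= 2)%N])
  (diameter R e <= 2%:E)%E.
Proof.
apply: (iffP idP) => [d2 x y|h].
  (* A strict bound on the infimum yields an actual path, and its length, an integer below 3, is at
     most 2. *)
  have : (gdist R e x y < 3%:E)%E.
    apply: (@le_lt_trans _ _ 2%:E); last by rewrite lte_fin ltr_nat.
    by apply: le_trans d2; apply: ereal_sup_ubound; exists (x, y).
  case/ereal_inf_lt => _ [s [ps ls] <-]; rewrite lte_fin ltr_nat => s3.
  by exists s.
apply: ge_ereal_sup => _ [[x y] _ <-] /=.
have [s [ps ls s2]] := h x y; apply: (@le_trans _ _ (size s)%:R%:E).
  by apply: ereal_inf_lbound; exists s.
by rewrite lee_fin ler_nat.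
Qed.

End Diameter.

(** * The graph whose edges express [x] as a product of two elements *)

Section ProductRelation.
Variable gT : finGroupType.
Implicit Types (x y z : gT) (S : {set gT}).
Local Open Scope group_scope.

(* When [y] and [z] both belong to [S], [x] is a product of two elements of
   the connection set of the graph. *)
Definition prodrel x : rel gT := fun y z =>
  [|| y * z == x, z * y == x, y * z^-1 == x, z^-1 * y == x,
      y^-1 * z == x, z * y^-1 == x, y^-1 * z^-1 == x | z^-1 * y^-1 == x].

Lemma prodrel_sym x : symmetric (prodrel x).
Proof.
move=> y z; rewrite /prodrel; case: (y * z == x); case: (z * y == x) => //=.
case: (y * z^-1 == x); case: (z^-1 * y == x); case: (y^-1 * z == x);
  case: (z * y^-1 == x) => //=.
by rewrite orbC.
Qed.

Lemma prodrelP x y z : reflect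
  (exists a b, [/\ a * b = x, (a == y) || (a == y^-1) & (b == z) || (b == z^-1)]
    \/ [/\ b * a = x, (a == y) || (a == y^-1) & (b == z) || (b == z^-1)])
  (prodrel x y z).
Proof.
apply: (iffP idP) => [|[a [b [] [<- /orP[] /eqP-> /orP[] /eqP->]]]];
  last 8 first; rewrite /prodrel ?eqxx ?orbT //.
case/or4P => [/eqP h|/eqP h|/eqP h|]; [exists y, z|exists y, z|exists y, z^-1|];
  rewrite ?eqxx ?orbT; [by left|by right|by left|].
case/or4P => [/eqP h|/eqP h|/eqP h|];
  [exists y, z^-1|exists y^-1, z|exists y^-1, z|];
  rewrite ?eqxx ?orbT; [by right|by left|by right|].
by case/orP => /eqP h; exists y^-1, z^-1; rewrite ?eqxx ?orbT; [left|right].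
Qed.

(** The eight equations of [prodrel] solved for [z], in the same order. Lower bounds on degrees
    reduce to exhibiting duplicate-free sublists. *)
Definition candidates x y : seq gT :=
  [:: y * x; x * y; y * x^-1; x^-1 * y; y^-1 * x; x * y^-1; y^-1 * x^-1; x^-1 * y^-1].

Lemma prodrelE x y z : prodrel x y z = (z \in candidates x y).
Proof.
have eL (a b c : gT) : (a * b == c) = (b == a^-1 * c) by rewrite -(inj_eq (mulgI a^-1)) mulKg.
have eR (a b c : gT) : (a * b == c) = (a == c * b^-1) by rewrite -(inj_eq (mulIg b^-1)) mulgK.
have eV (a b : gT) : (a^-1 == b) = (a == b^-1) by rewrite -(inj_eq invg_inj) invgK.
rewrite /prodrel /candidates !inE.
rewrite (eL y z) (eR z y) (eL y z^-1) (eR z^-1 y) (eL y^-1 z) (eR z y^-1) (eL y^-1 z^-1) (eR z^-1 y^-1).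
rewrite !eV !invMg !invgK.
by do 8 case: (z == _) => //=.
Qed.

Lemma card_prodrel x y : (#|[set z | prodrel x y z]%SET| <= 8)%N.
Proof.
apply: (@leq_trans #|candidates x y|); last exact: card_size.
by apply: subset_leq_card; apply/fintype.subsetP => z; rewrite inE prodrelE.
Qed.

Section Distance.
Variable R : realType.

Let conn S a := (a \in S) || (a^-1 \in S).

Let cayleyE S g h : cayley S g h = (g != h) && conn S (h * g^-1).
Proof. by rewrite /cayley /conn invMg invgK. Qed.

(** Two vertices [g], [k] are joined through [b * g] when [k * g^-1 = a * b]. If a factor is
    trivial, this walk would use a loop, which the Cayley graph omits, but the edge from [g] to [k]
    is then direct. *)
Lemma diameter_le2_products S :
  (forall x, x != 1 -> ~~ indep (prodrel x) S) ->
  (diameter R (cayley S) <= 2%:E)%E.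
Proof.
move=> h; apply/diameter_le2P => g k.
have [->|gk] := eqVneq g k; first by exists [::].
pose x := k * g^-1; have x1 : x != 1.
  by apply: contra gk => /eqP/divg1_eq ->.
have [a [b [abx Sa Sb]]] : exists a b, [/\ a * b = x, conn S a & conn S b].
  have /forall_inPn[y yS /forall_inPn[z zS]] := h x x1.
  rewrite negbK => /prodrelP[a [b [] [abx ay bz]]]; [exists a, b|exists b, a];
    split=> //; rewrite /conn;
    by [case/orP: ay => /eqP->; rewrite ?invgK ?yS ?orbT
      | case/orP: bz => /eqP->; rewrite ?invgK ?zS ?orbT].
have kE : k = a * b * g by rewrite abx mulgKV.
have [b1|b1] := eqVneq b 1.
  exists [:: k]; split=> //; rewrite /= andbT cayleyE gk -/x -abx b1 mulg1 //.
have [a1|a1] := eqVneq a 1.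
  by exists [:: k]; split=> //; rewrite /= andbT cayleyE gk -/x -abx a1 mul1g.
exists [:: b * g; k]; split=> //=; rewrite !cayleyE mulgK Sb andbT /= kE.
rewrite invMg -!mulgA mulKVg mulgV mulg1 Sa !andbT.
rewrite -{1}[g]mul1g (inj_eq (mulIg _)) eq_sym b1 /=.
by rewrite -{1}[b * g]mul1g (inj_eq (mulIg _)) eq_sym.
Qed.

(** The vertices 1 and [x] are too far apart. As [x] is its own inverse, [x \notin S] excludes an
    edge, and a middle vertex [w] would write [x] as the product of [x * w^-1] and [w]. *)
Lemma diameter_gt2_involution S x : x != 1 -> x * x = 1 -> x \notin S ->
  indep (prodrel x) S -> (2%:E < diameter R (cayley S))%E.
Proof.
move=> x1 xx xS /indepP Si; rewrite ltNge; apply/negP => /diameter_le2P.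
have xV : x^-1 = x by apply/eqP; rewrite eq_invg_mul xx.
have nx : ~~ conn S x by rewrite /conn xV orbb.
have sgn a : conn S a -> exists2 y, y \in S & (a == y) || (a == y^-1).
  by case/orP => aS; [exists a|exists a^-1]; rewrite ?invgK ?eqxx ?orbT.
case/(_ 1 x) => -[|w [|k [|? ?]]] [//= ps lx _].
- by rewrite lx eqxx in x1.
- by move: ps; rewrite cayleyE lx invg1 mulg1 (negPf nx) andbF.
move: ps; rewrite !cayleyE lx invg1 mulg1 andbT => /andP[/andP[_ /sgn[z zS wz]]].
case/andP=> _ /sgn[y yS xwy]; have /negP := Si y z yS zS; apply.
by apply/prodrelP; exists (x * w^-1), w; left; rewrite mulgKV.
Qed.

Lemma prob_diameter_gt2_le (p : R) : (0 <= p <= 1)%R ->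
  (subset_prob p (fun S => 2%:E < diameter R (cayley S))%E <=
   \sum_(x : gT | x != 1%g) subset_prob p (indep (prodrel x)))%R.
Proof.
move=> p01; apply: le_trans (subset_prob_union _ _ p01).
apply: subset_prob_mono => // S; rewrite ltNge; apply: contraR.
rewrite negb_exists => /forallP h; apply: diameter_le2_products => x x1.
by have := h x; rewrite x1.
Qed.

End Distance.

Definition proddeg x := degsum (prodrel x) [set: gT]%SET.

Lemma nbrs_prodrel x y : nbrs (prodrel x) [set: gT]%SET y = [set z in candidates x y]%SET.
Proof. by apply/setP => z; rewrite [RHS]finset.in_set -prodrelE !inE. Qed.

Lemma proddegE x : proddeg x = (\sum_y #|[set z in candidates x y]%SET|)%N.
Proof.
rewrite /proddeg /degsum; apply: eq_big => [y|y _]; first by rewrite inE.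
by rewrite nbrs_prodrel.
Qed.

Lemma card_candidates_ge x y s : uniq s -> {subset s <= candidates x y} ->
  (size s <= #|[set z in candidates x y]%SET|)%N.
Proof.
move=> us sc; rewrite -(card_uniqP us) subset_leq_card //.
by apply/fintype.subsetP => z /sc; rewrite inE.
Qed.

Lemma proddeg_ge x k (Y : {set gT}) :
  (forall y, y \in Y -> (k <= #|[set z in candidates x y]%SET|)%N) ->
  (k * #|Y| <= proddeg x)%N.
Proof.
move=> h; rewrite proddegE mulnC -sum_nat_const.
rewrite [leqRHS](bigID (fun y => y \in Y)) /=.
by apply: leq_trans (leq_addr _ _); apply: leq_sum.
Qed.

(** Every [y] has the two distinct neighbours [y x] and [y x^-1]. *)
Lemma proddeg_ge2 x : x * x != 1 -> (2 * #|gT| <= proddeg x)%N.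
Proof.
move=> xx; rewrite -cardsT; apply: proddeg_ge => y _.
apply: (card_candidates_ge (s := [:: y * x; y * x^-1])) => [|z]; last first.
  by rewrite !inE; case/orP => ->; rewrite ?orbT.
by rewrite /= inE andbT (inj_eq (mulgI _)) -eq_invg_mul eq_sym in xx *.
Qed.

(** The neighbours [y x] and [x y] of [y] differ unless [y] centralizes [x]. *)
Lemma proddeg_ge_cent x : (2 * #|gT| <= proddeg x + #|'C[x]|)%N.
Proof.
have e1 : #|'C[x]| = (\sum_y (y \in 'C[x]))%N.
  by rewrite -sum1_card big_mkcond; apply: eq_bigr => y _; case: (_ \in _).
rewrite proddegE e1 -big_split /= mulnC -sum_nat_const; apply: leq_sum => y _.
have [yC|yC] := boolP (y \in 'C[x]).
  rewrite addn1 ltnS; apply: (card_candidates_ge (s := [:: y * x])) => // z.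
  by rewrite !inE => ->.
rewrite addn0; apply: (card_candidates_ge (s := [:: y * x; x * y])) => [|z]; last first.
  by rewrite !inE; case/orP => ->; rewrite ?orbT.
by rewrite /= inE andbT; apply: contra yC => /eqP h; apply/cent1P.
Qed.

(** The identity is included, which makes this set closed under products; [sqrt1] contains the
    identity as well. *)
Definition center_inv : {set gT} := 
  [set x : gT | [forall y : gT, y * x == x * y] && (x * x == 1)]%SET.
Definition sqrt1 : {set gT} := [set y : gT | y * y == 1]%SET.

Lemma center_invP x :
  reflect ((forall y, commute y x) /\ x * x = 1) (x \in center_inv).
Proof.
rewrite inE; apply: (iffP andP) => [[/forallP h /eqP xx]|[h xx]].
  by split=> // y; apply/eqP/h.
by split; [apply/forallP => y; apply/eqP/h|apply/eqP].
Qed.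

Lemma candidates_center_inv x y : x \in center_inv ->
  candidates x y =i [:: y * x; y^-1 * x].
Proof.
case/center_invP => xC xx z.
have xV : x^-1 = x by apply/eqP; rewrite eq_invg_mul xx.
rewrite /candidates xV -(xC y) -(xC y^-1) !inE.
by case: (z == y * x); case: (z == _).
Qed.

(** The eight candidates collapse to [y x] and [y^-1 x], which coincide exactly when [y * y = 1]. *)
Lemma proddeg_center_inv x : x \in center_inv ->
  (proddeg x + #|sqrt1| = 2 * #|gT|)%N.
Proof.
move=> xZ; have e1 : #|sqrt1| = (\sum_y (y \in sqrt1))%N.
  by rewrite -sum1_card big_mkcond; apply: eq_bigr => y _; case: (_ \in _).
rewrite proddegE e1 -big_split /= mulnC -sum_nat_const; apply: eq_bigr => y _.
have -> : [set z in candidates x y]%SET = [set y * x; y^-1 * x]%SET.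
  by apply/setP => z; rewrite inE candidates_center_inv // !inE.
rewrite cards2 (inj_eq (mulIg _)) inE -eq_invg_mul eq_sym.
by case: (_ == _).
Qed.

Definition squares : {set gT} := [set y * y | y in [set: gT]]%SET.

Lemma prodrel_loopless x : x \in center_inv -> x \notin squares ->
  forall y, ~~ prodrel x y y.
Proof.
move=> xZ nsq y; have /center_invP[xC xx] := xZ.
rewrite prodrelE candidates_center_inv // !inE; apply/negP => /orP[]/eqP yE.
  move/negP: nsq; apply; apply/imsetP; exists 1 => //; rewrite mulg1.
  by apply: (mulgI y); rewrite -yE mulg1.
by move/negP: nsq; apply; apply/imsetP; exists y => //; rewrite {2}yE mulKVg.
Qed.

(** A common neighbour of [y] in both graphs would give [x = x'] or make [x * x'] the square of [y]
    or [y^-1]. The neighbourhoods are thus disjoint, so the exponents add up and the two events are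
    nearly independent. *)
Lemma proddeg_relU x x' : x \in center_inv -> x' \in center_inv ->
  x * x' \notin squares ->
  degsum (fun y z => prodrel x y z || prodrel x' y z) [set: gT]%SET =
  (proddeg x + proddeg x')%N.
Proof.
move=> xZ xZ' nsq; have /center_invP[xC xx] := xZ.
rewrite /proddeg /degsum -big_split; apply: eq_bigr => y _ /=.
rewrite -cardsUI [X in (_ + #|pred_of_set X|)%N](_ : _ = finset.set0); last first.
  apply/setP => z; rewrite !inE !prodrelE !candidates_center_inv // !inE.
  apply/negP => /andP[/orP[]/eqP-> /orP[]].
  - rewrite (inj_eq (mulgI _)) => /eqP x'E; move/negP: nsq; apply.
    by apply/imsetP; exists 1 => //; rewrite -x'E xx mulg1.
  - move/eqP/(congr1 (fun u => y * u * x)); rewrite mulKVg !mulgA => yE.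
    move/negP: nsq; apply; apply/imsetP; exists y => //.
    by rewrite -xC -yE -!mulgA xx mulg1.
  - move/eqP/(congr1 (fun u => u * x)); rewrite -!mulgA xx mulg1 => yE.
    move/negP: nsq; apply; apply/imsetP; exists y^-1 => //.
    by rewrite {2}yE mulKg -xC.
  rewrite (inj_eq (mulgI _)) => /eqP x'E; move/negP: nsq; apply.
  by apply/imsetP; exists 1 => //; rewrite -x'E xx mulg1.
rewrite cards0 addn0; congr #|pred_of_set _|; apply/setP => z.
by rewrite !inE.
Qed.

End ProductRelation.

(** * Second moment *)

Section SecondMoment.
Variables (R : realType) (T : finType) (p : R).
Hypothesis p01 : 0 <= p <= 1.

Let weight (S : {set T}) : R := \prod_(x : T) (if x \in S then p else 1 - p).

Let probE (B : pred {set T}) : subset_prob p B = \sum_S (B S)%:R * weight S.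
Proof.
rewrite /subset_prob big_mkcond; apply: eq_bigr => S _.
by case: (B S); rewrite ?mul1r ?mul0r.
Qed.

(** Chebyshev's inequality for the number of [i] in [X] for which [A i] occurs. A pair that is not
    bad contributes at most [b] to the second moment; each [i] has at most [m] bad partners, each
    contributing at most the probability of [A i]. *)
Lemma second_moment (I : finType) (X : {set I}) (A : I -> pred {set T})
    (bad : rel I) (m : nat) (a b : R) :
  (0 < #|X|)%N -> 0 < a -> 0 <= b ->
  (forall i, i \in X -> a <= subset_prob p (A i)) ->
  (forall i j, i \in X -> j \in X -> ~~ bad i j ->
     subset_prob p (predI (A i) (A j)) <= b) ->
  (forall i, i \in X -> (#|[set j in X | bad i j]%SET| <= m)%N) ->
  subset_prob p (fun S => [forall i in X, ~~ A i S]) <=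
    b / a ^+ 2 - 1 + m%:R / (#|X|%:R * a).
Proof.
move=> X0 a0 b0 Aa Ab bad_m.
pose N (S : {set T}) : R := \sum_(i in X) (A i S)%:R.
pose E : R := \sum_(i in X) subset_prob p (A i).
have M0 : 0 < #|X|%:R :> R by rewrite ltr0n.
have Ma0 : 0 < #|X|%:R * a by exact: mulr_gt0.
have EMa : #|X|%:R * a <= E.
  by rewrite mulr_natl -sumr_const; apply: ler_sum => i iX; exact: Aa.
have E0 : 0 < E by exact: lt_le_trans EMa.
have EN : \sum_S N S * weight S = E.
  rewrite /E (eq_bigr _ (fun i _ => probE (A i))) exchange_big /=.
  by apply: eq_bigr => S _; rewrite mulr_suml.
have EN2 : \sum_S N S ^+ 2 * weight S =
    \sum_(i in X) \sum_(j in X) subset_prob p (predI (A i) (A j)).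
  under [RHS]eq_bigr => i _ do (under eq_bigr do rewrite probE; rewrite exchange_big /=).
  rewrite exchange_big /=; apply: eq_bigr => S _.
  rewrite expr2 {1}/N mulr_suml mulr_suml; apply: eq_bigr => i _.
  rewrite /N mulr_sumr mulr_suml; apply: eq_bigr => j _.
  by rewrite -natrM mulnb.
have w_ge0 S : 0 <= weight S.
  by case/andP: p01 => p0 p1; apply: prodr_ge0 => x _; case: ifP; rewrite ?subr_ge0.
have total : \sum_S weight S = 1.
  by rewrite -(subset_prob_total T p) probE; apply: eq_bigr => S _; rewrite mul1r.
have cheb : subset_prob p (fun S => [forall i in X, ~~ A i S]) * E ^+ 2 <=
    \sum_S N S ^+ 2 * weight S - E ^+ 2.
  have -> : \sum_S N S ^+ 2 * weight S - E ^+ 2 =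
      \sum_S (N S - E) ^+ 2 * weight S.
    transitivity (\sum_S (N S ^+ 2 * weight S - (2 * E) * (N S * weight S) +
        E ^+ 2 * weight S)); last by apply: eq_bigr => S _; ring.
    by rewrite big_split sumrB /= -!mulr_sumr EN total; ring.
  rewrite probE mulr_suml; apply: ler_sum => S _.
  rewrite mulrAC ler_wpM2r //; have [/forall_inP h|_] := boolP [forall i in X, ~~ A i S].
    have -> : N S = 0 by rewrite /N big1 // => i /h /negPf ->.
    by rewrite mul1r sub0r sqrrN.
  by rewrite mul0r sqr_ge0.
have pairs : \sum_S N S ^+ 2 * weight S <= #|X|%:R ^+ 2 * b + m%:R * E.
  rewrite EN2.
  apply: (@le_trans _ _ (\sum_(i in X) (#|X|%:R * b + m%:R * subset_prob p (A i)))).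
    apply: ler_sum => i iX; rewrite (bigID (bad i)) /= addrC; apply: lerD.
      apply: (@le_trans _ _ (\sum_(j in X) b)); last by rewrite sumr_const mulr_natl.
      rewrite [leRHS](bigID (fun j => ~~ bad i j)) /=.
      apply: ler_wpDr; first exact: sumr_ge0.
      by apply: ler_sum => j /andP[jX nb]; exact: Ab.
    apply: (@le_trans _ _ (\sum_(j in [set j in X | bad i j]%SET) subset_prob p (A i))).
      rewrite [leRHS](eq_bigl (fun j => (j \in X) && bad i j)); last first.
        by move=> j; rewrite inE.
      by apply: ler_sum => j _; apply: subset_prob_mono => // S /andP[].
    rewrite sumr_const -[leLHS]mulr_natl ler_wpM2r ?subset_prob_ge0 //.
    by rewrite ler_nat; exact: bad_m.
  rewrite big_split /= -!mulr_sumr sumr_const -[b *+ _]mulr_natl.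
  by rewrite mulrA expr2.
have h := le_trans cheb (lerB pairs (lexx (E ^+ 2))).
have E20 : 0 < E ^+ 2 by exact: exprn_gt0.
have h2 : subset_prob p (fun S => [forall i in X, ~~ A i S]) <=
    #|X|%:R ^+ 2 * b / E ^+ 2 + m%:R / E - 1.
  rewrite -(ler_pM2r E20); apply: (le_trans h).
  rewrite mulrBl mulrDl divfK ?gt_eqF // mul1r expr2 mulrA divfK ?gt_eqF //.
apply: (le_trans h2).
have d1 : #|X|%:R ^+ 2 * b / E ^+ 2 <= b / a ^+ 2.
  have -> : b / a ^+ 2 = #|X|%:R ^+ 2 * b / (#|X|%:R * a) ^+ 2.
    by rewrite exprMn -mulf_div divff ?mul1r // expf_neq0 ?gt_eqF.
  apply: ler_wpM2l; first by rewrite mulr_ge0 ?exprn_ge0.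
  by rewrite lef_pV2 ?posrE ?exprn_gt0 // lerXn2r ?nnegrE // ltW.
have d2 : m%:R / E <= m%:R / (#|X|%:R * a).
  by apply: ler_wpM2l; rewrite ?ler0n // lef_pV2 ?posrE.
lra.
Qed.

End SecondMoment.

(** * Explicit first and second moment bounds for a single group *)

Section FiniteBounds.
Variables (R : realType) (gT : finGroupType) (p : R).
Local Notation n := #|gT|%:R.

(** Degree at most 8 in [indep_prob_le] gives [192 = 3 * 8^2] and the condition [8 p <= 1/2]. *)
Lemma prob_diameter_gt2_bound : 0 <= p -> p <= 1 / 16 ->
  subset_prob p (fun S : {set gT} => 2%:E < diameter R (cayley S))%E <=
  \sum_(x : gT | x != 1%g)
    expR (- (p ^+ 2 * (proddeg x)%:R / 2) + 192 * p ^+ 3 * n).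
Proof.
move=> p0 p16; have p01 : 0 <= p <= 1 by lra.
apply: le_trans (prob_diameter_gt2_le gT p01) _; apply: ler_sum => x _.
have dp : 8%:R * p <= 1 / 2 by lra.
have := indep_prob_le p01 (prodrel_sym x) (card_prodrel x) dp.
move/le_trans; apply; rewrite ler_expR; lra.
Qed.

Lemma center_invM (x y : gT) : x \in center_inv gT -> y \in center_inv gT ->
  (x * y)%g \in center_inv gT.
Proof.
move=> /center_invP[xC xx] /center_invP[yC yy]; apply/center_invP; split.
  by move=> z; apply: commuteM.
by rewrite mulgA -(mulgA x) (xC y) mulgA xx mul1g.
Qed.

(** Second moment over the elements of [center_inv] that are not squares, whose graphs are loopless;
    a pair is bad when its product is a square. The lower bound with degree 8 has error
    [128 = 2 * 8^2], the joint upper bound with degree 16 has [768 = 3 * 16^2], and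
    [1024 = 768 + 2 * 128] is the error in the ratio [b / a^2]. *)
Lemma prob_diameter_le2_bound (m : nat) : 0 <= p -> p <= 1 / 32 ->
  (#|center_inv gT :&: squares gT| <= m)%N ->
  (m < #|center_inv gT|)%N ->
  subset_prob p (fun S : {set gT} => diameter R (cayley S) <= 2%:E)%E <=
  expR (1024 * p ^+ 3 * n) / (1 - p) ^+ 2 - 1 +
  m%:R / ((#|center_inv gT| - m)%:R * ((1 - p) *
     expR (- (p ^+ 2 * (n - #|sqrt1 gT|%:R / 2)) - 128 * p ^+ 3 * n))).
Proof.
move=> p0 p32 sqm mZ; have p01 : 0 <= p <= 1 by lra.
set Z := center_inv gT; pose X := Z :\: squares gT.
have cX : (#|Z| - m <= #|X|)%N.
  by rewrite /X cardsD leq_sub2l.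
have X0 : (0 < #|X|)%N by apply: leq_trans cX; rewrite subn_gt0.
pose d : R := n - #|sqrt1 gT|%:R / 2.
have dE x : x \in Z -> (proddeg x)%:R = 2 * d.
  move/proddeg_center_inv/(congr1 (fun k : nat => k%:R : R)).
  by rewrite natrD natrM /d; lra.
pose A (x : gT) (S : {set gT}) := (x \notin S) && indep (prodrel x) S.
set a := (1 - p) * expR _.
have a0 : 0 < a by rewrite mulr_gt0 ?expR_gt0 //; lra.
have n0 : 0 <= n :> R by exact: ler0n.
have p34 : p ^+ 4 * n <= p ^+ 3 * n.
  by rewrite ler_wpM2r // exprS ler_piMl ?exprn_ge0 //; lra.
have Aa x : x \in X -> a <= subset_prob p (A x).
  rewrite inE => /andP[xsq xZ].
  have := indep_prob_avoid_ge (prodrel x) p01 x.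
  have dp : 8%:R * p ^+ 2 <= 1 / 2 by nra.
  have := indep_prob_ge p01 (prodrel_sym x) (card_prodrel x) dp (prodrel_loopless xZ xsq).
  rewrite -/(proddeg x) dE // => h1 h2; apply: le_trans h2.
  rewrite /a; apply: ler_wpM2l; first by lra.
  by apply: le_trans h1; rewrite ler_expR -/d; lra.
pose b := expR (- (p ^+ 2 * (2 * d)) + 768 * p ^+ 3 * n).
pose bad (x y : gT) := (x * y)%g \in squares gT.
have Ab x y : x \in X -> y \in X -> ~~ bad x y ->
    subset_prob p (predI (A x) (A y)) <= b.
  rewrite !finset.in_setD => /andP[_ xZ] /andP[_ yZ] nb.
  pose e : rel gT := fun u v => prodrel x u v || prodrel y u v.
  have e_sym : symmetric e by move=> u v; rewrite /e !(prodrel_sym _ u).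
  have e_deg u : (#|[set v | e u v]%SET| <= 16)%N.
    have -> : [set v | e u v]%SET = [set v | prodrel x u v]%SET :|: [set v | prodrel y u v]%SET.
      by apply/setP => v; rewrite !inE.
    apply: leq_trans (leq_card_setU _ _) _.
    exact: (leq_add (card_prodrel x u) (card_prodrel y u)).
  have dp : 16%:R * p <= 1 / 2 by lra.
  have := indep_prob_le p01 e_sym e_deg dp.
  have -> : degsum e [set: gT]%SET = (proddeg x + proddeg y)%N.
    exact: (proddeg_relU xZ yZ nb).
  rewrite natrD !dE // => h; apply: (@le_trans _ _ (subset_prob p (indep e))).
    apply: subset_prob_mono => // S /andP[/andP[_ /indepP h1] /andP[_ /indepP h2]].
    by apply/indepP => u v uS vS; rewrite negb_or h1 ?h2.
  by apply: le_trans h _; rewrite ler_expR; lra.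
have bad_m x : x \in X -> (#|[set y in X | bad x y]%SET| <= m)%N.
  rewrite finset.in_setD => /andP[_ xZ]; apply: leq_trans sqm.
  rewrite -(card_imset _ (mulgI x)); apply: subset_leq_card.
  apply/fintype.subsetP => u /imsetP[y]; rewrite finset.in_set => /andP[yX xy] ->.
  move: yX; rewrite finset.in_setD => /andP[_ yZ].
  by rewrite finset.in_setI center_invM.
have b0 : 0 <= b by exact: expR_ge0.
have := second_moment p01 X0 a0 b0 Aa Ab bad_m.
set u := subset_prob _ _ => hu; set v := subset_prob _ _.
have vu : v <= u.
  apply: subset_prob_mono => // S d2; apply/forall_inP => x; rewrite finset.in_setD => /andP[xsq xZ].
  apply/negP => /andP[xS xi]; move: d2; rewrite leNgt; apply/negP; rewrite negbK.
  have /center_invP[_ xx] := xZ.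
  apply: diameter_gt2_involution xi => //; apply: contraNneq xsq => ->.
  by apply/imsetP; exists 1%g; rewrite ?mulg1.
apply: (le_trans vu); apply: (le_trans hu).
have q0 : 0 < 1 - p by lra.
apply: lerD; last first.
  apply: ler_wpM2l; rewrite ?ler0n // lef_pV2 ?posrE ?mulr_gt0 ?ltr0n ?subn_gt0 ?expR_gt0 //.
  by rewrite ler_pM2r // ler_nat.
rewrite lerD2r /b /a exprMn -expRM_natl invfM mulrCA [leRHS]mulrC.
rewrite ler_pM2l ?invr_gt0 ?exprn_gt0 // -expRN -expRD ler_expR -/d; lra.
Qed.

End FiniteBounds.

(** * Asymptotics *)

Section Asymptotics.
Variable R : realType.

Lemma ln_nat_large (K : R) : exists n0, forall n, (n0 <= n)%N -> K <= ln (n%:R : R).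
Proof.
exists (Num.truncn (expR K)).+1 => n hn.
have h : expR K < n%:R.
  by apply: lt_le_trans (truncnS_gt _) _; rewrite ler_nat.
by rewrite -[K]expRK ler_ln ?posrE ?expR_gt0 ?(ltW h) // (lt_trans _ h) ?expR_gt0.
Qed.

(** With [L = ln n], the exponential series gives [n >= L^4 / 24], so the square of [L] times the
    rate, [a L^3 / n], is at most [24 a / L]. The second bound follows from [L >= 1]. *)
Lemma rate_small (a eta : R) : 0 <= a -> 0 < eta -> exists n0, forall n, (n0 <= n)%N ->
  ln (n%:R) * Num.sqrt (a * (ln n%:R / n%:R)) <= eta /\
  Num.sqrt (a * (ln n%:R / n%:R)) <= eta.
Proof.
move=> a0 eta0.
have [n0 hn0] := ln_nat_large (Num.max 1 (24 * a / eta ^+ 2)).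
exists (maxn n0 1) => n; rewrite geq_max => /andP[/hn0].
rewrite ge_max => /andP[L1 La] n1.
set L := ln n%:R in L1 La *; set s := Num.sqrt _.
have n_gt0 : 0 < n%:R :> R by rewrite ltr0n.
have L0 : 0 < L by lra.
have s0 : 0 <= s by exact: sqrtr_ge0.
suff Ls : L * s <= eta.
  by split=> //; apply: le_trans Ls; rewrite -[leLHS]mul1r ler_wpM2r.
have Ln : L ^+ 4 / 24 <= n%:R.
  have := expR_ge1Dxn 3 (ltW L0); rewrite lnK ?posrE //.
  by have -> : (4`!)%N = 24%N by []; lra.
have Ln0 : 0 <= a * (L / n%:R) by rewrite mulr_ge0 // divr_ge0 // ltW.
rewrite -ler_sqr ?nnegrE ?mulr_ge0 ?(ltW L0) ?(ltW eta0) // exprMn sqr_sqrtr //.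
have -> : L ^+ 2 * (a * (L / n%:R)) = a * L ^+ 3 / n%:R by field; rewrite gt_eqF.
rewrite ler_pdivrMr //.
apply: le_trans (ler_wpM2l (sqr_ge0 eta) Ln).
move: La; rewrite ler_pdivrMr ?exprn_gt0 // => La.
have : 0 <= L ^+ 3 * (L * eta ^+ 2 - 24 * a).
  by rewrite mulr_ge0 ?exprn_ge0 ?subr_ge0 // ltW.
by lra.
Qed.

Lemma expR_le_inv (x : R) : x < 1 -> expR x <= (1 - x)^-1.
Proof.
move=> x1; rewrite -[leLHS]invrK -expRN lef_pV2 ?posrE ?expR_gt0 ?subr_gt0 //.
exact: expR_ge1Dx.
Qed.

Lemma sqr_rate (gT : finGroupType) (a : R) : 0 <= a ->
  threshold_rate gT a ^+ 2 = a * (ln (#|gT|%:R) / #|gT|%:R).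
Proof.
move=> a0; rewrite sqr_sqrtr // mulr_ge0 // divr_ge0 ?ler0n // ln_ge0 //.
by rewrite ler1n; apply/card_gt0P; exists 1%g.
Qed.

Lemma threshold_rate_ge0 (gT : finGroupType) (a : R) : 0 <= threshold_rate gT a.
Proof. exact: sqrtr_ge0. Qed.

Lemma threshold_rate_mono (gT : finGroupType) (a b : R) :
  a <= b -> threshold_rate gT a <= threshold_rate gT b.
Proof.
move=> ab; apply: ler_wsqrtr; apply: ler_wpM2r => //.
rewrite divr_ge0 ?ler0n // ln_ge0 // ler1n; apply/card_gt0P; by exists 1%g.
Qed.

(** At the rate, [192 p^3 n = 192 a p ln n], which is eventually at most 1/2; hence the factor 2,
    which exceeds [exp(1/2)]. *)
Lemma prob_diameter_gt2_asymp (a : R) : 0 < a -> exists n0,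
  forall gT : finGroupType, (n0 <= #|gT|)%N ->
  [/\ threshold_rate gT a <= 1 &
  subset_prob (threshold_rate gT a)
    (fun S : {set gT} => 2%:E < diameter R (cayley S))%E <=
  2 * \sum_(x : gT | x != 1%g)
    expR (- (a * ln #|gT|%:R * ((proddeg x)%:R / (2 * #|gT|%:R))))].
Proof.
move=> a0.
have K0 : 0 < 384 * a by rewrite mulr_gt0 ?ltr0n.
have e0 : 0 < Num.min (1 / 16) (1 / (384 * a)).
  by rewrite lt_min; apply/andP; split; [rewrite divr_gt0|exact: divr_gt0].
have [n0 hn0] := rate_small (ltW a0) e0.
exists n0 => gT /hn0; rewrite !le_min -/(threshold_rate gT a).
set p := threshold_rate gT a; set L := ln _ => -[/andP[_ h1] /andP[h2 _]].
have p0 : 0 <= p by exact: threshold_rate_ge0.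
have n_gt0 : 0 < #|gT|%:R :> R by rewrite ltr0n; apply/card_gt0P; exists 1%g.
have p2 : p ^+ 2 = a * (L / #|gT|%:R) by rewrite sqr_rate // ltW.
split; first by lra.
apply: le_trans (prob_diameter_gt2_bound gT p0 h2) _.
rewrite mulr_sumr; apply: ler_sum => x _; rewrite expRD mulrC; apply: ler_pM.
- exact: expR_ge0.
- exact: expR_ge0.
- have -> : 192 * p ^+ 3 * #|gT|%:R = 192 * a * (L * p).
    rewrite exprS p2; field; by rewrite gt_eqF.
  move: h1; rewrite (ler_pdivlMr _ _ K0) => h1.
  apply: le_trans (expR_le_inv _) _; first by lra.
  rewrite -[leRHS]invrK lef_pV2 ?posrE ?invr_gt0 //; lra.
- by rewrite ler_expR p2 le_eqVlt; apply/orP; left; apply/eqP; field; rewrite gt_eqF.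
Qed.

Lemma expR_ratio_le (t x p : R) : t <= 1 / 32 -> x <= t -> 0 <= p -> p <= t ->
  expR x / (1 - p) ^+ 2 <= 1 + 6 * t.
Proof.
move=> t32 xt p0 pt; have t0 : 0 <= t by lra.
rewrite ler_pdivrMr; last by rewrite exprn_gt0 //; lra.
apply: (@le_trans _ _ (1 - t)^-1).
  by apply: le_trans (expR_le_inv (x := t) _); [rewrite ler_expR|lra].
apply: (@le_trans _ _ ((1 + 6 * t) * (1 - t) ^+ 2)); last first.
  by apply: ler_wpM2l; [lra|rewrite lerXn2r ?nnegrE //; lra].
rewrite -[leLHS]mul1r ler_pdivrMr; last by lra.
have h1 : 0 <= t * (1 - 32 * t) by rewrite mulr_ge0 //; lra.
have h2 : 0 <= t ^+ 3 * (1 - t) by rewrite mulr_ge0 ?exprn_ge0 //; lra.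
have h3 : 0 <= t ^+ 3 by rewrite exprn_ge0.
have h4 : 0 <= t ^+ 2 by exact: sqr_ge0.
have -> : (1 + 6 * t) * (1 - t) ^+ 2 * (1 - t) =
    1 + 3 * t - 15 * t ^+ 2 + 17 * t ^+ 3 - 6 * t ^+ 4 by ring.
lra.
Qed.

(** The last hypothesis says that [|Z| n^(- a lam) >= n^d]: a power of [n] many uncovered [x] are
    expected. The factor 8 collects three losses of 1/2, from [|Z| - m], from [1 - p] and from the
    cubic error term. *)
Lemma prob_diameter_le2_small (gT : finGroupType) (a d t p : R) (m : nat) :
  t <= 1 / 32 -> 0 <= p -> p <= t ->
  p ^+ 2 * #|gT|%:R <= a * ln #|gT|%:R ->
  1024 * p ^+ 3 * #|gT|%:R <= t ->
  (#|center_inv gT :&: squares gT| <= m)%N ->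
  2 * m%:R <= d * ln #|gT|%:R -> 0 <= a -> 
  a * ln #|gT|%:R * (1 - #|sqrt1 gT|%:R / (2 * #|gT|%:R)) <=
    ln #|center_inv gT|%:R - d * ln #|gT|%:R ->
  subset_prob p (fun S : {set gT} => diameter R (cayley S) <= 2%:E)%E <=
  6 * t + 8 * m%:R / expR (d * ln #|gT|%:R).
Proof.
set n : R := #|gT|%:R; set L := ln n; set Z := center_inv gT; set i : R := #|sqrt1 gT|%:R.
move=> t32 p0 pt p2n p3n sqm dL2 a0 hZ.
have n_ge1 : 1 <= n by rewrite ler1n; apply/card_gt0P; exists 1%g.
have n_gt0 : 0 < n by exact: lt_le_trans n_ge1.
have L0 : 0 <= L by exact: ln_ge0.
have Z1 : (0 < #|Z|)%N.
  apply/card_gt0P; exists 1%g; apply/center_invP.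
  by split; [move=> y; exact: commute1|rewrite mulg1].
have iN : i <= n by rewrite ler_nat max_card.
have ZR0 : 0 < #|Z|%:R :> R by rewrite ltr0n.
have lam0 : 0 <= 1 - i / (2 * n).
  have n20 : 0 < 2 * n by rewrite mulr_gt0.
  by rewrite subr_ge0 ler_pdivrMr // mul1r (le_trans iN) // ler_peMl ?(ltW n_gt0) // ler1n.
have dLZ : d * L <= ln #|Z|%:R.
  by rewrite -subr_ge0; apply: le_trans hZ; rewrite !mulr_ge0.
have ZdL : expR (d * L) <= #|Z|%:R.
  by rewrite -[leRHS]lnK ?posrE // ler_expR.
have dL1 : 1 + d * L <= expR (d * L) by exact: expR_ge1Dx.
have m0 : 0 <= m%:R :> R by exact: ler0n.
have mZR : 2 * m%:R < #|Z|%:R :> R by clear p3n; lra.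
have mZ : (m < #|Z|)%N by rewrite -(ltr_nat R); clear p3n; lra.
have p32 : p <= 1 / 32 by exact: le_trans t32.
apply: le_trans (prob_diameter_le2_bound p0 p32 sqm mZ) _.
rewrite -/n -/Z -/i.
have first := expR_ratio_le t32 p3n p0 pt.
rewrite [6 * t](_ : _ = 1 + 6 * t - 1); last by rewrite addrAC subrr add0r.
apply: lerD; first by rewrite lerD2r.
have {p3n} s2 : 128 * p ^+ 3 * n <= 1 / 2.
  apply: (@le_trans _ _ t); last by clear p3n; lra.
  apply: le_trans p3n; rewrite -!mulrA ler_wpM2r ?mulr_ge0 ?exprn_ge0 ?(ltW n_gt0) //.
  by rewrite ler_nat.
clear first.
have ex : expR (d * L) / #|Z|%:R / 2 <=
    expR (- (p ^+ 2 * (n - i / 2)) - 128 * p ^+ 3 * n).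
  rewrite expRD; apply: ler_pM => //.
    rewrite -[X in _ / X]lnK ?posrE // -expRN -expRD ler_expR.
    have : p ^+ 2 * (n - i / 2) <= a * L * (1 - i / (2 * n)).
      have -> : n - i / 2 = n * (1 - i / (2 * n)) by field; rewrite gt_eqF.
      by rewrite mulrA ler_wpM2r.
    by clear s2; lra.
  rewrite expRN lef_pV2 ?posrE ?expR_gt0 //.
  apply: le_trans (expR_le_inv _) _; first by apply: le_lt_trans s2 _; clear; lra.
  rewrite -[leRHS]invrK lef_pV2 ?posrE ?invr_gt0 ?subr_gt0 //.
    by rewrite lerBrDl -lerBrDr; apply: le_trans s2 _; clear; lra.
  by apply: le_lt_trans s2 _; clear; lra.
have den : expR (d * L) / 8 <= (#|Z| - m)%:R * ((1 - p) *
    expR (- (p ^+ 2 * (n - i / 2)) - 128 * p ^+ 3 * n)).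
  have -> : expR (d * L) / 8 = (#|Z|%:R / 2) * ((1 / 2) * (expR (d * L) / #|Z|%:R / 2)).
    by field; rewrite gt_eqF.
  apply: ler_pM; [by rewrite divr_ge0 ?ltW| | |].
  - by rewrite !mulr_ge0 ?expR_ge0 ?invr_ge0 ?ltW.
  - by rewrite natrB ?(ltnW mZ) //; clear s2 ex; lra.
  - by apply: ler_pM => //; rewrite ?divr_ge0 ?expR_ge0 ?ltW //; clear s2 ex; lra.
have E0 : 0 < expR (d * L) by exact: expR_gt0.
apply: (@le_trans _ _ (m%:R / (expR (d * L) / 8))).
  apply: ler_wpM2l => //; rewrite lef_pV2 ?posrE ?divr_gt0 //.
  by apply: lt_le_trans den; rewrite divr_gt0.
by rewrite invf_div mulrA [m%:R * _]mulrC.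
Qed.

Lemma prob_diameter_le2_asymp (a d eta : R) (m : nat) : 0 <= a -> 0 < d -> 0 < eta ->
  exists n0, forall gT : finGroupType, (n0 <= #|gT|)%N ->
  (#|center_inv gT :&: squares gT| <= m)%N ->
  a * ln #|gT|%:R * (1 - #|sqrt1 gT|%:R / (2 * #|gT|%:R)) <=
    ln #|center_inv gT|%:R - d * ln #|gT|%:R ->
  forall p, 0 <= p <= threshold_rate gT a ->
  subset_prob p (fun S : {set gT} => diameter R (cayley S) <= 2%:E)%E <= eta.
Proof.
move=> a0 d0 eta0.
pose t : R := Num.min (1 / 32) (eta / 12).
have t0 : 0 < t by rewrite lt_min !divr_gt0.
have t32 : t <= 1 / 32 by rewrite /t ge_min lexx.
have teta : t <= eta / 12 by rewrite /t ge_min lexx orbT.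
clearbody t.
have K0 : 0 < 1024 :> R by rewrite ltr0n.
have K1 : 1 <= 1024 :> R by rewrite ler1n.
have [K KE] : exists K : R, K = 1024 by exists 1024.
rewrite -KE in K0 K1.
(* Chosen so that [1024 p^3 n <= 1024 a q ln n <= t], where [q] is the rate; [a + 1] replaces [a] to
   avoid dividing by 0. *)
pose e : R := t / (K * (a + 1)).
have a1 : 0 < a + 1 by lra.
have Ka0 : 0 < K * (a + 1) by exact: mulr_gt0.
have e0 : 0 < e by exact: divr_gt0.
have et : e <= t.
  rewrite /e ler_pdivrMr // ler_peMr ?(ltW t0) //.
  by apply: (le_trans K1); rewrite ler_peMr ?(ltW K0) // lerDr.
have h3 : K * ((a + 1) * e) = t by rewrite /e; field; rewrite !gt_eqF.
clearbody e.
have [n1 hn1] := rate_small a0 e0.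
have [n2 hn2] := ln_nat_large (Num.max (2 * m%:R / d) (16 * m%:R / (d * eta))).
exists (maxn n1 n2) => gT; rewrite geq_max => /andP[/hn1 + /hn2].
rewrite ge_max -/(threshold_rate gT a).
set n : R := #|gT|%:R; set L := ln n; set q := threshold_rate gT a.
move=> [Lq qe] /andP[L1 L2] sqm hZ p /andP[p0 pq].
have pt : p <= t by apply: le_trans pq (le_trans qe et).
have n_ge1 : 1 <= n by rewrite ler1n; apply/card_gt0P; exists 1%g.
have n_gt0 : 0 < n by exact: lt_le_trans n_ge1.
have L0 : 0 <= L by exact: ln_ge0.
have q2 : q ^+ 2 = a * (L / n) by rewrite sqr_rate.
have p2q2 : p ^+ 2 <= a * (L / n) by rewrite -q2 lerXn2r ?nnegrE // (le_trans p0).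
have p2n : p ^+ 2 * n <= a * L by move: p2q2; rewrite mulrA ler_pdivlMr.
have p3n : 1024 * p ^+ 3 * n <= t.
  have h1 : p ^+ 3 * n <= a * (L * q).
    apply: (@le_trans _ _ (p * (a * L))).
      by rewrite exprS -mulrA ler_wpM2l.
    by rewrite mulrC -mulrA !ler_wpM2l.
  have h2 : a * (L * q) <= (a + 1) * e.
    by apply: ler_pM => //; [rewrite mulr_ge0 ?threshold_rate_ge0|rewrite lerDl].
  by rewrite -KE -h3 -mulrA; apply: (ler_wpM2l (ltW K0)); exact: le_trans h2.
have dL2 : 2 * m%:R <= d * L by move: L1; rewrite ler_pdivrMr // [L * d]mulrC.
apply: le_trans (prob_diameter_le2_small t32 p0 pt p2n p3n sqm dL2 a0 hZ) _.
rewrite -/n -/L; clear p3n KE.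
have dL1 : 1 + d * L <= expR (d * L) by exact: expR_ge1Dx.
have de0 : 0 < d * eta by exact: mulr_gt0.
have dL3 : 16 * m%:R <= eta * (d * L).
  have -> : eta * (d * L) = L * (d * eta) by ring.
  by rewrite -(ler_pdivrMr _ _ de0).
have E0 : 0 < expR (d * L) by exact: expR_gt0.
have : 8 * m%:R / expR (d * L) <= eta / 2.
  rewrite ler_pdivrMr //.
  have : eta * (d * L) <= eta * expR (d * L).
    by rewrite ler_wpM2l ?(ltW eta0) // (le_trans _ dL1) // lerDr.
  clear -dL3; lra.
clear -teta; lra.
Qed.

Lemma diameter_le2_upset (gT : finGroupType) (S S' : {set gT}) : S \subset S' ->
  (diameter R (cayley S) <= 2%:E)%E -> (diameter R (cayley S') <= 2%:E)%E.
Proof.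
move=> /fintype.subsetP SS' /diameter_le2P h; apply/diameter_le2P => x y.
have [s [ps ls s2]] := h x y; exists s; split=> //; apply: sub_path ps => g k.
by rewrite /cayley => /andP[-> /orP[] /SS' ->]; rewrite ?orbT.
Qed.

Lemma prob_gt2_le2 (gT : finGroupType) (p : R) :
  subset_prob p (fun S : {set gT} => 2%:E < diameter R (cayley S))%E =
  1 - subset_prob p (fun S : {set gT} => diameter R (cayley S) <= 2%:E)%E.
Proof.
by rewrite subset_probC; congr (1 - _); apply: eq_subset_prob => S /=; rewrite leNgt.
Qed.

Local Open Scope classical_set_scope.
Local Open Scope ring_scope.

(** Reduction to two counting statements: below [c] the expected number of uncovered elements of
    [center_inv] grows like a power of the order, and above [c] the first moment over the whole
    group vanishes. *)
Lemma threshold_criterion (G : nat -> finGroupType) (c : R) (m : nat) :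
  0 < c -> (#|G k| @[k --> \oo] --> \oo) ->
  (forall k, (#|center_inv (G k) :&: squares (G k)| <= m)%N) ->
  (forall a, 0 < a < c -> exists2 d, 0 < d & \forall k \near \oo,
     a * ln #|G k|%:R * (1 - #|sqrt1 (G k)|%:R / (2 * #|G k|%:R)) <=
     ln #|center_inv (G k)|%:R - d * ln #|G k|%:R) ->
  (forall a, c < a -> forall eta, 0 < eta -> \forall k \near \oo,
     \sum_(x : G k | x != 1%g)
       expR (- (a * ln #|G k|%:R * ((proddeg x)%:R / (2 * #|G k|%:R)))) <= eta) ->
  is_diam2_threshold G c.
Proof.
move=> c0 Goo sqm low up; split=> // eps eps0 p p01.
have large n0 : \forall k \near \oo, (n0 <= #|G k|)%N.
  exact: (Goo _ (nbhs_infty_ge n0)).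
split=> hp; apply/cvgrPdist_le => eta eta0.
  (* The value [c - eps] may be negative; enlarging it to [c / 2] keeps [a] positive and still below
     [c]. *)
  pose a := Num.max (c - eps) (c / 2).
  have a0 : 0 < a by rewrite lt_max divr_gt0 ?orbT.
  have ac : a < c by rewrite gt_max; apply/andP; split; lra.
  have [|d d0 hd] := low a; first by rewrite a0.
  have [n0 hn0] := prob_diameter_le2_asymp m (ltW a0) d0 eta0.
  near=> k.
  rewrite prob_gt2_le2 opprB addrC subrK ger0_norm ?subset_prob_ge0 //.
  apply: hn0 => //; [by near: k; exact: large|by near: k|].
  case/andP: (p01 k) => -> _ /=; apply: (@le_trans _ _ (threshold_rate (G k) (c - eps))).
    by near: k.
  by apply: threshold_rate_mono; rewrite /a le_max lexx.
have ca : c < c + eps by lra.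
have a0 : 0 < c + eps by lra.
have [n0 hn0] := prob_diameter_gt2_asymp a0.
have eta2 : 0 < eta / 2 by lra.
near=> k.
have nk : (n0 <= #|G k|)%N by near: k; exact: large.
have [q1 qle] := hn0 (G k) nk.
have q0 := threshold_rate_ge0 (G k) (c + eps).
have := p01 k => /andP[pk0 pk1].
rewrite ger0_norm ?subr_ge0 ?subset_prob_le1 //.
(* Having diameter at most 2 is preserved by adding elements, so it suffices to treat [p] equal to
   the rate. *)
have mon : subset_prob (threshold_rate (G k) (c + eps))
      (fun S : {set G k} => diameter R (cayley S) <= 2%:E)%E <=
    subset_prob (p k) (fun S : {set G k} => diameter R (cayley S) <= 2%:E)%E.
  apply: subset_prob_upset => //; first by near: k.
  by move=> S S'; exact: diameter_le2_upset.
have : \sum_(x : G k | x != 1%g)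
    expR (- ((c + eps) * ln #|G k|%:R * ((proddeg x)%:R / (2 * #|G k|%:R)))) <= eta / 2.
  by near: k; exact: up.
by move: qle; rewrite prob_gt2_le2; lra.
Unshelve. all: by end_near.
Qed.

End Asymptotics.

(** * Groups consisting mostly of involutions *)

Section ManyInvolutions.
Variable gT : finGroupType.
Local Open Scope group_scope.
Local Notation S := (sqrt1 gT).
Local Notation n := #|gT|.
Local Notation d := (2 * #|S| - n)%N.

Lemma sqrt1P (y : gT) : reflect (y * y = 1) (y \in S).
Proof. by rewrite inE; exact: eqP. Qed.

Lemma sqrt1_sub_comm (A : {group gT}) : A \subset S ->
  forall a b, a \in A -> b \in A -> commute a b.
Proof.
move=> /fintype.subsetP AS a b aA bA.
have /sqrt1P aa := AS a aA; have /sqrt1P bb := AS b bA.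
have /sqrt1P ab := AS (a * b) (groupM aA bA).
have aV : a^-1 = a by apply/eqP; rewrite eq_invg_mul aa.
have bV : b^-1 = b by apply/eqP; rewrite eq_invg_mul bb.
have : (a * b)^-1 = a * b by apply/eqP; rewrite eq_invg_mul ab.
by rewrite invMg aV bV.
Qed.

(* [a s] squares to 1 iff [a] commutes with the involution [s]. *)
Lemma card_sqrt1_rcoset (A : {group gT}) s : A \subset S -> s \in S ->
  #|S :&: A :* s| = #|'C_A[s]|.
Proof.
move=> /fintype.subsetP AS /sqrt1P ss; rewrite -(card_rcoset 'C_A[s] s).
apply: eq_card => y; apply/setIP/rcosetP => [[/sqrt1P yy /rcosetP[a aA yE]]|[a]].
  exists a => //; rewrite inE aA; apply/cent1P.
  have /sqrt1P aa := AS a aA.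
  have aV : a^-1 = a by apply/eqP; rewrite eq_invg_mul aa.
  have sV : s^-1 = s by apply/eqP; rewrite eq_invg_mul ss.
  have : (a * s)^-1 = a * s by apply/eqP; rewrite -yE eq_invg_mul yy.
  by rewrite invMg aV sV /commute => ->.
case/setIP => aA /cent1P sa ->; split; last by apply/rcosetP; exists a.
have /sqrt1P aa := AS a aA; apply/sqrt1P.
by rewrite mulgA -(mulgA a s) -sa mulgA aa mul1g.
Qed.

(** Double counting: each [y] in [S] lies in [A :* x] for exactly [#|A|] elements [x]. *)
Lemma sum_card_sqrt1_rcoset (A : {group gT}) :
  (\sum_(x : gT) #|S :&: A :* x| = #|A| * #|S|)%N.
Proof.
transitivity (\sum_(x : gT) \sum_(y in S) (y \in A :* x))%N.
  apply: eq_bigr => x _; rewrite -sum1_card big_mkcond [RHS]big_mkcond.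
  by apply: eq_bigr => y _; rewrite inE; case: (y \in S); case: (y \in _).
rewrite exchange_big /= mulnC -sum_nat_const; apply: eq_bigr => y _.
rewrite -(card_rcoset A y) -sum1_card [RHS]big_mkcond; apply: eq_bigr => x _.
by rewrite rcoset_sym; case: (_ \in _).
Qed.

Section Maximal.
Variable A : {group gT}.
Hypothesis maxA : [max A | A \subset S].
Hypothesis many : (n < 2 * #|S|)%N.

Let AS : A \subset S. Proof. by case/maxgroupP: maxA. Qed.

(** [A] is a 2-group, so a proper subgroup has even index. If [s] centralized [A], then [A] and [s]
    would generate a larger group inside [S], against maximality. *)
Lemma cent_maximal s : s \in S -> s \notin A -> (2 * #|'C_A[s]| %| #|A|)%N.
Proof.
move=> sS sA.
have A2 : (2%N).-group A.
  apply/pgroupP => q q_pr /(Cauchy q_pr)[x xA xq].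
  have /sqrt1P xx : x \in S by exact: (fintype.subsetP AS).
  have : (#[x] %| 2)%N by rewrite order_dvdn expgS expg1 xx.
  by rewrite xq (dvdn_prime2 q_pr).
have [k Ak] := p_natP A2.
have CA : 'C_A[s] \subset A by exact: subsetIl.
have : (#|'C_A[s]| %| 2 ^ k)%N by rewrite -Ak cardSg.
case/(dvdn_pfactor _ _ (isT : prime 2)) => j jk Cj.
rewrite Cj Ak -expnS dvdn_exp2l // ltn_neqAle jk andbT; apply/negP => /eqP jkE.
have CAE : 'C_A[s] = A.
  by apply/eqP; rewrite eqEcard CA Cj jkE Ak /=.
have sC : s \in 'C(A).
  apply/centP => a; rewrite -{1}CAE => /setIP[_ /cent1P].
  by move/commute_sym.
have [_ /(_ (A <*> <[s]>)%G)] := maxgroupP maxA.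
have sub : A <*> <[s]> \subset S.
  rewrite cent_joinEr ?cycle_subG //; apply/fintype.subsetP => y /mulsgP[a t aA /cycleP[l ->] ->].
  have /sqrt1P aa : a \in S by exact: (fintype.subsetP AS).
  have /sqrt1P ss := sS.
  have c : commute a (s ^+ l) by apply: commuteX; apply: commute_sym; exact: (centP sC).
  apply/sqrt1P; rewrite mulgA -(mulgA a (s ^+ l)) -c mulgA aa mul1g.
  by rewrite -expgMn ?ss ?expg1n.
move=> /(_ sub (joing_subl _ _)) AE; move/negP: sA; apply.
by rewrite -AE mem_gen // inE cycle_id orbT.
Qed.

Let g x := #|S :&: A :* x|.

Let gA x : x \in A -> g x = #|A|.
Proof. by move=> xA; rewrite /g rcoset_id // (finset.setIidPr AS). Qed.

Let g_coset x y : y \in A :* x -> g y = g x.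
Proof. by move=> yx; rewrite /g (rcoset_eqP yx). Qed.

Let g_cent x s : s \in S :&: A :* x -> g x = #|'C_A[s]|.
Proof. by case/setIP => sS sx; rewrite -(g_coset sx) /g card_sqrt1_rcoset. Qed.

Let g_dvd x : x \notin A -> (0 < g x)%N -> (2 * g x %| #|A|)%N.
Proof.
move=> xA /card_gt0P[s sI]; rewrite (g_cent sI); case/setIP: sI => sS sx.
apply: cent_maximal => //; apply: contra xA => sA.
by move: sx; rewrite -rcoset_sym => /rcosetP[a aA ->]; rewrite groupM.
Qed.

Let g_le x : x \notin A -> (2 * g x <= #|A|)%N.
Proof.
move=> xA; have [->|] := posnP (g x); first by rewrite muln0.
by move/(g_dvd xA); apply: dvdn_leq.
Qed.

(** The shortfall, doubled, of [S] below half of the coset [A :* x]. By [g_le] the subtraction never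
    truncates outside [A]. *)
Let deficit x := (#|A| - 2 * g x)%N.

(** The count of [S] over all cosets. [S] fills [A] and at most half of every other coset, so the
    excess of [S] over half the group is what the deficits leave of [A]. *)
Let sum_deficit : (\sum_(x | x \notin A) deficit x + #|A| * d = #|A| * #|A|)%N.
Proof.
have e1 : (\sum_(x | x \notin A) deficit x + 2 * \sum_(x | x \notin A) g x =
    (n - #|A|) * #|A|)%N.
  rewrite big_distrr -big_split /=.
  under eq_bigr => x xA do rewrite subnK ?g_le //.
  rewrite sum_nat_const; congr (_ * _)%N.
  by rewrite -[n](cardC (mem A)) addKn; apply: eq_card => x; rewrite !inE.
have e2 : (#|A| * #|A| + \sum_(x | x \notin A) g x = #|A| * #|S|)%N.
  rewrite -sum_card_sqrt1_rcoset [RHS](bigID (fun x => x \in A)) /=; congr addn.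
  by rewrite -sum_nat_const; apply: eq_bigr => x xA; rewrite -[RHS]/(g x) gA.
have An : (#|A| <= n)%N by exact: max_card.
move: e1 e2; set u := (\sum_(x | _) deficit x)%N; set v := (\sum_(x | _) g x)%N.
rewrite mulnBl mulnBr => e1 e2.
have h1 : (#|A| * #|A| <= n * #|A|)%N by rewrite leq_mul2r An orbT.
have h2 : (#|A| * n <= #|A| * (2 * #|S|))%N by rewrite leq_mul2l ltnW ?orbT.
by move: e1 e2 h1 h2; rewrite !(mulnC n) (mulnCA #|A| 2); lia.
Qed.

Let deficit_coset x : x \notin A ->
  (#|A| * deficit x <= \sum_(y | y \notin A) deficit y)%N.
Proof.
move=> xA; rewrite [leqRHS](bigID (fun y => y \in A :* x)) /=.
apply: leq_trans (leq_addr _ _).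
rewrite -(card_rcoset A x) -sum_nat_const; apply: eq_leq.
apply: eq_big => [y|y yx]; last by rewrite /deficit (g_coset yx).
case: (boolP (y \in A :* x)) => yx; rewrite ?andbF ?andbT //.
apply/esym; apply: contra xA => yA.
by move: yx; rewrite -rcoset_sym => /rcosetP[a aA ->]; rewrite groupM.
Qed.

Let A0 : (0 < #|A|)%N. Proof. exact: cardG_gt0. Qed.

Lemma defect_le_card : (d <= #|A|)%N.
Proof.
have : (#|A| * d <= #|A| * #|A|)%N by rewrite -sum_deficit leq_addl.
by rewrite leq_pmul2l.
Qed.

(** One coset carries at most the total deficit, so [deficit x + d <= #|A|]. *)
Let defect_le_g x : x \notin A -> (d <= 2 * g x)%N.
Proof.
move=> xA; have := deficit_coset xA; rewrite -(leq_add2r (#|A| * d)) sum_deficit.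
by rewrite -mulnDr leq_pmul2l // /deficit; have := g_le xA; lia.
Qed.

(* A coset [A x] with [x] outside [A] holds [#|A| / 2^j] elements of [S] with
   [j >= 1], so a nonzero deficit is at least [#|A| / 2]. As the deficits of
   these cosets add up to [#|A| - d < #|A|], at most one of them is nonzero. *)
Lemma defect_dvd : (d %| n)%N.
Proof.
have dA : (d %| #|A|)%N; last first.
  by apply: dvdn_trans dA _; rewrite -cardsT; apply/cardSg/finset.subsetT.
have d0 : (0 < d)%N by rewrite subn_gt0.
have [/existsP[x /andP[xA dx]]|] := boolP [exists x, (x \notin A) && (0 < deficit x)%N].
  have gx0 : (0 < g x)%N by have := defect_le_g xA; lia.
  (* With one deficient coset, [sum_deficit] divided by [#|A|] reads [deficit x + d = #|A|], that is
     [d = 2 * g x]. With none, it reads [d = #|A|]. *)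
  suff -> : (d = 2 * g x)%N by exact: g_dvd.
  have half z : z \notin A -> (0 < deficit z)%N -> (#|A| <= 2 * deficit z)%N.
    move=> zA; have gz0 : (0 < g z)%N by have := defect_le_g zA; lia.
    have /dvdnP[q qE] := g_dvd zA gz0.
    rewrite /deficit qE; case: q qE => [|[|q]] qE; rewrite ?mul0n ?mul1n; nia.
  have only y : y \notin A -> y \notin A :* x -> deficit y = 0%N.
    move=> yA yx; apply/eqP; rewrite -leqn0 leqNgt; apply/negP => dy.
    have h1 : (#|A| * deficit x + #|A| * deficit y <= \sum_(z | z \notin A) deficit z)%N.
      rewrite [leqRHS](bigID (fun z => z \in A :* x)) /=; apply: leq_add.
        rewrite -(card_rcoset A x) -sum_nat_const; apply: eq_leq.
        apply: eq_big => [z|z zx]; last by rewrite /deficit (g_coset zx).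
        case: (boolP (z \in A :* x)) => zx; rewrite ?andbF ?andbT //.
        apply/esym; apply: contra xA => zA.
        by move: zx; rewrite -rcoset_sym => /rcosetP[a aA ->]; rewrite groupM.
      rewrite -(card_rcoset A y) -sum_nat_const.
      rewrite [leqRHS](bigID (fun z => z \in A :* y)) /=.
      apply: leq_trans (leq_addr _ _); apply: eq_leq.
      apply: eq_big => [z|z zy]; last by rewrite /deficit (g_coset zy).
      case: (boolP (z \in A :* y)) => zy; rewrite ?andbF ?andbT //.
      apply/esym/andP; split.
        apply: contra yA => zA.
        by move: zy; rewrite -rcoset_sym => /rcosetP[a aA ->]; rewrite groupM.
      apply: contra yx => zx; rewrite -(rcoset_eqP zx) rcoset_sym.
      by rewrite -(rcoset_eqP zy) rcoset_refl.
    have := half x xA dx; have := half y yA dy; move: h1.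
    rewrite -mulnDr => h1 h2 h3.
    have h4 : (#|A| * (deficit x + deficit y) + #|A| * d <= #|A| * #|A|)%N.
      by rewrite -sum_deficit leq_add2r.
    by move: h4; rewrite -mulnDr leq_pmul2l //; lia.
  have : (\sum_(y | y \notin A) deficit y = #|A| * deficit x)%N.
    rewrite [LHS](bigID (fun y => y \in A :* x)) /= [X in (_ + X)%N]big1 ?addn0.
      rewrite -(card_rcoset A x) -sum_nat_const.
      apply: eq_big => [y|y /andP[_ yx]]; last by rewrite /deficit (g_coset yx).
      case: (boolP (y \in A :* x)) => yx; rewrite ?andbF ?andbT //.
      apply: contra xA => yA.
      by move: yx; rewrite -rcoset_sym => /rcosetP[a aA ->]; rewrite groupM.
    by move=> y /andP[]; exact: only.
  have := sum_deficit => /[swap] ->; rewrite -mulnDr => /eqP.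
  by rewrite eqn_pmul2l // /deficit => /eqP; have := g_le xA; lia.
rewrite negb_exists => /forallP none.
have := sum_deficit; rewrite big1 ?add0n => [/eqP|x xA].
  by rewrite eqn_pmul2l // => /eqP ->.
by have := none x; rewrite xA -eqn0Ngt => /eqP.
Qed.

Lemma rcoset_sqrt1 x : exists2 s, s \in S :&: A :* x & (d <= 2 * #|'C_A[s]|)%N.
Proof.
have d0 : (0 < d)%N by rewrite subn_gt0.
have [xA|xA] := boolP (x \in A).
  exists 1; last first.
    rewrite (finset.setIidPl _); first by have := defect_le_card; lia.
    by apply/fintype.subsetP => a _; apply/cent1P; exact: commute1.
  by rewrite rcoset_id // inE group1 andbT; apply/sqrt1P; rewrite mulg1.
have := defect_le_g xA => dg.
have /card_gt0P[s sI] : (0 < g x)%N by lia.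
by exists s => //; rewrite -(g_cent sI).
Qed.

(** Since [d <= #|A|], there are at most [r] cosets of [A]. In each, [rcoset_sqrt1] gives some [s]
    whose centralizer in [A] has index at most [2 r], because [#|A| <= r * d]. The intersection of
    these centralizers has index at most [(2 r)^r] in [A]; it is central, as [A] is abelian and
    together with the chosen [s] generates the group. *)
Lemma card_center_inv_ge r : (0 < r)%N -> (n = r * d)%N ->
  (n <= r * (2 * r) ^ r * #|center_inv gT|)%N.
Proof.
move=> r0 nE; have d0 : (0 < d)%N by rewrite subn_gt0.
have An : (#|A| <= r * d)%N by rewrite -nE max_card.
(* The default 1 is never reached, by [rcoset_sqrt1]. *)
pose sb x := if [pick s in S :&: A :* x | (d <= 2 * #|'C_A[s]|)%N] is Some s then s else 1.
have sbP x : sb x \in S :&: A :* x /\ (d <= 2 * #|'C_A[sb x]|)%N.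
  rewrite /sb; case: pickP => [s /andP[] //|none].
  have [s sI dC] := rcoset_sqrt1 x.
  by have := none s; rewrite sI dC.
pose X := [seq sb (repr B) | B <- enum (rcosets A [set: gT])].
have key (Y : seq gT) : all (fun s => (d <= 2 * #|'C_A[s]|)%N) Y ->
    (#|A| <= (2 * r) ^ size Y * #|'C_A([set s in Y])|)%N.
  elim: Y => [|s Y IH] /=.
    rewrite expn0 mul1n (finset.setIidPl _) //; apply/fintype.subsetP => a _.
    by apply/centP => y; rewrite inE.
  case/andP => ds /IH {}IH.
  have CE : 'C_A([set t in s :: Y]) = 'C_A[s] :&: 'C_A([set t in Y]).
    apply/setP => a; rewrite !finset.in_setI; case: (a \in A) => //=.
    apply/centP/andP => [h|[/cent1P h1 /centP h2 y]].
      split.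
        by apply/cent1P; apply: h; rewrite !inE eqxx.
      by apply/centP => y; rewrite inE => yY; apply: h; rewrite !inE yY orbT.
    rewrite !inE => /orP[/eqP->|yY]; first exact: h1.
    by apply: h2; rewrite inE.
  (* Indices in [A] are submultiplicative under intersection, because the product set of the two
     subgroups stays in [A]. *)
  have prod := mul_cardG 'C_A[s]%G 'C_A([set t in Y])%G.
  have le1 : (#|('C_A[s] * 'C_A([set t in Y]))%g| <= #|A|)%N.
    by apply/subset_leq_card/mul_subG; exact: finset.subsetIl.
  have A2C : (#|A| <= 2 * r * #|'C_A[s]|)%N.
    by apply: leq_trans An _; rewrite (mulnC 2%N r) -mulnA leq_mul2l ds orbT.
  have arith (a c1 c2 t ps q b : nat) : (0 < a)%N -> (ps <= a)%N ->
      (a <= b * c1)%N -> (a <= t * c2)%N -> (c1 * c2 = ps * q)%N -> (a <= b * t * q)%N.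
    move=> a0 psa abc atc cpq; rewrite -(leq_pmul2l a0).
    apply: (leq_trans (leq_mul abc atc)); rewrite mulnACA cpq.
    by rewrite [(_ * (ps * q))%N]mulnCA leq_mul2r psa orbT.
  by rewrite CE expnS; exact: (arith _ _ _ _ _ _ _ A0 le1 A2C IH prod).
have allX : all (fun s => (d <= 2 * #|'C_A[s]|)%N) X.
  by apply/allP => s /mapP[B _ ->]; case: (sbP (repr B)).
have sX : (size X * #|A| = n)%N.
  by rewrite size_map -cardE mulnC -/(indexg _ _) Lagrange ?cardsT ?finset.subsetT.
have Xr : (size X <= r)%N.
  have dA := defect_le_card.
  by rewrite -(leq_pmul2r d0) -nE -[leqRHS]sX leq_mul2l dA orbT.
have CZ : 'C_A([set s in X]) \subset center_inv gT.
  apply/fintype.subsetP => z /setIP[zA /centP zX]; apply/center_invP; split; last first.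
    by apply/sqrt1P; exact: (fintype.subsetP AS).
  move=> y; pose B := A :* y.
  have BX : sb (repr B) \in X.
    by apply/map_f; rewrite mem_enum; apply/rcosetsP; exists y.
  have [/setIP[_ sB] _] := sbP (repr B).
  have : y \in A :* sb (repr B).
    by rewrite (rcoset_eqP sB) rcoset_sym mem_repr_rcoset.
  case/rcosetP => a aA ->; apply: commute_sym; apply: commuteM.
    exact: (sqrt1_sub_comm AS).
  by apply: zX; rewrite inE.
have := key X allX; have := subset_leq_card CZ.
set cc := #|_ :&: _|; set z := #|_| => cz Ac.
rewrite -{1}sX mulnC; apply: (@leq_trans ((2 * r) ^ size X * cc * size X)).
  by rewrite leq_mul2r Ac orbT.
by rewrite mulnC -!mulnA leq_mul // leq_mul // leq_pexp2l // muln_gt0.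
Qed.

End Maximal.

Lemma many_involutions : (n < 2 * #|S|)%N -> exists r,
  [/\ (0 < r)%N, (n = r * (2 * #|S| - n))%N &
      (n <= r * (2 * r) ^ r * #|center_inv gT|)%N].
Proof.
move=> many.
have [|A maxA _] := @maxgroup_exists _ (fun A : {group gT} => A \subset S) 1%G.
  by apply/fintype.subsetP => x /set1P ->; apply/sqrt1P; rewrite mulg1.
have /dvdnP[r rE] := defect_dvd maxA many.
have n0 : (0 < n)%N by apply/card_gt0P; exists 1.
have r0 : (0 < r)%N by case: r rE n0 => // ->; rewrite mul0n.
by exists r; split=> //; exact: (card_center_inv_ge maxA many r0 rE).
Qed.

End ManyInvolutions.

(** * Thresholds above 4/3 *)

Section Necessity.
Variable R : realType.

(** The inverse of [1 - i / (2 n)] when [n = r (2 i - n)]. It decreases from 2 at [r = 1] towards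
    4/3. *)
Definition crat (r : nat) : R := 4 * r%:R / (3 * r%:R - 1).

Lemma cratV (r : nat) : (0 < r)%N -> (crat r)^-1 = 3 / 4 - (4 * r%:R)^-1.
Proof.
move=> r0; have r1 : 1 <= r%:R :> R by rewrite ler1n.
rewrite /crat invf_div; field; rewrite gt_eqF //; lra.
Qed.

Lemma crat_gt0 (r : nat) : (0 < r)%N -> 0 < crat r.
Proof.
move=> r0; have r1 : 1 <= r%:R :> R by rewrite ler1n.
by rewrite /crat divr_gt0 //; lra.
Qed.

Lemma cratV_mono (r s : nat) : (0 < r)%N -> (r <= s)%N -> (crat r)^-1 <= (crat s)^-1.
Proof.
move=> r0 rs; have s0 := leq_trans r0 rs; rewrite !cratV // lerD2l lerN2.
by rewrite lef_pV2 ?posrE ?mulr_gt0 ?ltr0n // ler_pM2l // ler_nat.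
Qed.

Lemma crat_bracket (c : R) : 4 / 3 < c -> c <= 2 ->
  (forall r, (0 < r)%N -> c != crat r) ->
  exists2 r, (0 < r)%N & crat r.+1 < c < crat r.
Proof.
move=> c43 c2 ne.
pose P r := (0 < r)%N && (crat r < c).
have exP : exists r, P r.
  have d0 : 0 < 3 * c - 4 by lra.
  (* For positive [r], [crat r < c] amounts to [c < r (3 c - 4)]. *)
  exists (Num.truncn (c / (3 * c - 4))).+1; rewrite /P /=.
  set r := _.+1; have : c / (3 * c - 4) < r%:R by exact: truncnS_gt.
  have r1 : 1 <= r%:R :> R by rewrite ler1n.
  rewrite ltr_pdivrMr // /crat ltr_pdivrMr; last by lra.
  by lra.
case: (ex_minnP exP) => -[|[|r]] /andP[// _ rc] rmin.
  move: rc; rewrite /crat (_ : 3 * 1%:R - 1 = 2 :> R); last by ring.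
  by rewrite ltr_pdivrMr //; lra.
exists r.+1 => //; rewrite rc /= lt_neqAle ne //= leNgt; apply/negP => h.
by have := rmin r.+1; rewrite /P h ltnn => /(_ isT).
Qed.

Variable gT : finGroupType.
Local Notation n := (#|gT|%:R : R).
Local Notation lam := (1 - #|sqrt1 gT|%:R / (2 * n)).

Lemma order_gt0 : 0 < n.
Proof. by rewrite ltr0n; apply/card_gt0P; exists 1%g. Qed.

(** If [x^2 = 1] but [x] is not central, its centralizer has index at least 2 and [proddeg_ge_cent]
    loses at most half of the order; otherwise [proddeg_ge2] applies. *)
Lemma proddeg_ge_noncentral (x : gT) : x \notin center_inv gT ->
  (3 * #|gT| <= 2 * proddeg x)%N.
Proof.
move=> xZ; have [xx|xx] := eqVneq (x * x)%g 1%g; last first.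
  by have := proddeg_ge2 xx; lia.
have xC : (2 * #|'C[x]%g| <= #|gT|)%N.
  have sT : 'C[x]%g \subset [set: gT]%SET by exact: finset.subsetT.
  have pr : (1 < #|[set: gT]%SET : 'C[x]|%g)%N.
    rewrite indexg_gt1; apply: contra xZ => /fintype.subsetP h.
    apply/center_invP; split=> // y; apply: commute_sym; apply/cent1P.
    by have := h y; rewrite cent1C inE; apply.
  rewrite -cardsT -(Lagrange sT) mulnC leq_mul2l.
  by rewrite pr orbT.
by have := proddeg_ge_cent x; lia.
Qed.

Lemma proddeg_lam (x : gT) : x \in center_inv gT -> (proddeg x)%:R / (2 * n) = lam.
Proof.
move/proddeg_center_inv/(congr1 (fun k : nat => k%:R : R)); rewrite natrD natrM => h.
have n0 := order_gt0; have -> : (proddeg x)%:R = 2 * n - #|sqrt1 gT|%:R :> R by lra.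
by field; rewrite gt_eqF.
Qed.

Lemma proddeg_ratio_ge (b : R) (x : gT) : b <= 3 / 4 -> b <= lam ->
  b <= (proddeg x)%:R / (2 * n).
Proof.
move=> b34 bl; have n0 := order_gt0.
have [xZ|xZ] := boolP (x \in center_inv gT); first by rewrite proddeg_lam.
apply: (le_trans b34); rewrite ler_pdivlMr ?mulr_gt0 //.
by have := proddeg_ge_noncentral xZ; rewrite -(ler_nat R) !natrM; lra.
Qed.

(** If [y * y = s], then [y * z] is also a square root of [s] for each [z] in [center_inv]. *)
Lemma card_squares : (#|squares gT| * #|center_inv gT| <= #|gT|)%N.
Proof.
pose rt (s : gT) := if [pick y | (y * y == s)%g] is Some y then y else 1%g.
have rtP s : s \in squares gT -> (rt s * rt s)%g = s.
  case/imsetP => y _ ->; rewrite /rt; case: pickP => [z /eqP //|/(_ y)].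
  by rewrite eqxx.
rewrite -cardsX -cardsT.
pose f (sz : gT * gT) := (rt sz.1 * sz.2)%g.
have f_inj : {in finset.setX (squares gT) (center_inv gT) &, injective f}.
  move=> [s z] [s' z'] /setXP[sS zZ] /setXP[sS' zZ'] /= fE.
  have sq u v : u \in squares gT -> v \in center_inv gT ->
      (rt u * v * (rt u * v))%g = u.
    move=> uS /center_invP[vC vv].
    by rewrite mulgA -(mulgA (rt u) v) -(vC (rt u)) mulgA rtP // -mulgA vv mulg1.
  have ss : s = s' by rewrite -(sq s z) // -(sq s' z') //; move: fE; rewrite /f /= => ->.
  by move: fE; rewrite /f /= ss => /mulgI ->.
rewrite -(card_in_imset f_inj); apply: subset_leq_card; exact: finset.subsetT.
Qed.

(** The gap: below 3/4, [lam] takes only the values [(crat r)^-1], so falling under the value at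
    [r0.+1] means being at most the value at [r0]. *)
Lemma lam_small (r0 : nat) : (0 < r0)%N -> lam < (crat r0.+1)^-1 ->
  lam <= (crat r0)^-1 /\
  (#|gT| <= r0 * (2 * r0) ^ r0 * #|center_inv gT|)%N.
Proof.
move=> r00 lamlt; have n0 := order_gt0.
have many : (#|gT| < 2 * #|sqrt1 gT|)%N.
  rewrite -(ltr_nat R) natrM.
  have : lam < 3 / 4.
    apply: lt_trans lamlt _; rewrite cratV // gtrBl invr_gt0 mulr_gt0 ?ltr0n //.
  by rewrite ltrBlDr -ltrBlDl ltr_pdivlMr ?mulr_gt0 //; lra.
have [r [r_gt0 nE nZ]] := many_involutions many.
have r1 : 0 < r%:R :> R by rewrite ltr0n.
have lamE : lam = (crat r)^-1.
  rewrite cratV //; move: nE => /(congr1 (fun k : nat => k%:R : R)).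
  rewrite natrM natrB ?(ltnW many) // natrM => nE.
  have -> : #|sqrt1 gT|%:R = (n + n / r%:R) / 2 :> R.
    by rewrite {2}nE; field; rewrite gt_eqF.
  by field; rewrite !gt_eqF.
have rr : (r <= r0)%N.
  rewrite leqNgt; apply/negP => h; move: lamlt; rewrite lamE ltNge.
  by rewrite cratV_mono.
split; first by rewrite lamE cratV_mono.
apply: (leq_trans nZ); rewrite leq_mul2r; apply/orP; right.
apply: leq_mul => //; apply: (@leq_trans ((2 * r0) ^ r)%N).
  by rewrite leq_exp2r // leq_mul2l rr.
by rewrite leq_pexp2l // muln_gt0 r00.
Qed.

End Necessity.

Section ThresholdNecessity.
Variable R : realType.
Local Open Scope classical_set_scope.
Local Open Scope ring_scope.

(** Suppose [crat r0.+1 < c < crat r0]. Slightly below [c] the diameter exceeds 2, so the first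
    moment cannot be small and [lam] is below [(crat r0.+1)^-1]. By the gap it is at most
    [(crat r0)^-1], and then the second moment makes diameter at most 2 unlikely slightly above [c],
    a contradiction. *)
Lemma threshold_necessary (G : nat -> finGroupType) (c : R) :
  (#|G k| @[k --> \oo] --> \oo) -> is_diam2_threshold G c -> 4 / 3 < c -> c <= 2 ->
  exists r : nat, (0 < r)%N /\ c = crat R r.
Proof.
move=> Goo [c0 thr] c43 c2; apply: contrapT => none.
have ne r : (0 < r)%N -> c != crat R r.
  by move=> r0; apply/eqP => cr; apply: none; exists r.
have [r0 r00 /andP[bc cb]] := crat_bracket c43 c2 ne.
have large n0 : \forall k \near \oo, (n0 <= #|G k|)%N.
  exact: (Goo _ (nbhs_infty_ge n0)).
pose eps := Num.min ((c - crat R r0.+1) / 2) ((crat R r0 - c) / 2).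
have eps0 : 0 < eps by rewrite lt_min !divr_gt0 ?subr_gt0.
have eps1 : eps <= (c - crat R r0.+1) / 2 by rewrite /eps ge_min lexx.
have eps2 : eps <= (crat R r0 - c) / 2 by rewrite /eps ge_min lexx orbT.
clearbody eps.
(* Capped to be a probability for every [k]; the cap is inactive for large [k]. *)
pose p a k := Num.min 1 (threshold_rate (G k) a) : R.
have p01 a k : 0 <= p a k <= 1.
  by rewrite /p le_min ler01 threshold_rate_ge0 ge_min lexx.
have p_le a k : p a k <= threshold_rate (G k) a by rewrite /p ge_min lexx orbT.
have [gt2 _] := thr eps eps0 (p (c - eps)) (p01 _).
have [_ le2] := thr eps eps0 (p (c + eps)) (p01 _).
have b0 : 0 < crat R r0.+1 by exact: crat_gt0.
have b1 : 0 < crat R r0 by exact: crat_gt0.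
pose a := c - eps; have ab : crat R r0.+1 < a by rewrite /a; lra.
have a0 : 0 < a by exact: lt_trans ab.
pose t := a / crat R r0.+1 - 1.
have t0 : 0 < t by rewrite subr_gt0 ltr_pdivlMr // mul1r.
pose a' := c + eps; have ab' : a' < crat R r0 by rewrite /a'; lra.
have a'0 : 0 < a' by rewrite /a'; lra.
(* Half of the slack absorbs the index bound [m]; the other half is the growth exponent of the
   second moment. *)
pose d := (1 - a' / crat R r0) / 2.
have d0 : 0 < d by rewrite divr_gt0 // subr_gt0 ltr_pdivrMr // mul1r.
have h2 : (0 : R) < 1 / 2 by lra.
pose m := (r0 * (2 * r0) ^ r0)%N.
have [n1 hn1] := prob_diameter_gt2_asymp a0.
have [n2 hn2] := prob_diameter_le2_asymp m (ltW a'0) d0 h2.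
(* [7 / t] forces [n^(- t) <= 1/8], which makes the first moment bound at most 1/4; [ln m / d]
   forces [m <= n^d]. *)
have [n3 hn3] := ln_nat_large (Num.max (7 / t) (ln m%:R / d)).
have [n4 hn4] := prob_diameter_gt2_asymp a'0.
have {}gt2 : subset_prob (p a k)
    (fun S : {set G k} => (2%:E < diameter R (cayley S))%E) @[k --> \oo] --> (1 : R).
  by apply: gt2; apply: nearW => k; exact: p_le.
have {}le2 : subset_prob (p a' k)
    (fun S : {set G k} => (diameter R (cayley S) <= 2%:E)%E) @[k --> \oo] --> (1 : R).
  apply: le2; near=> k.
  have nk : (n4 <= #|G k|)%N by near: k; exact: large.
  by have [h _] := hn4 (G k) nk; rewrite /p le_min lexx h.
suff : \forall k \near \oo, False by case=> k _ /(_ k (leqnn _)).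
have {}gt2 := (cvgrPdist_lt _ _).1 gt2 _ h2; have {}le2 := (cvgrPdist_lt _ _).1 le2 _ h2.
near=> k.
have nk1 : (n1 <= #|G k|)%N by near: k; exact: large.
have nk2 : (n2 <= #|G k|)%N by near: k; exact: large.
have nk3 : (n3 <= #|G k|)%N by near: k; exact: large.
have gt2k : `|1 - subset_prob (p a k)
   (fun S : {set G k} => (2%:E < diameter R (cayley S))%E)| < 1 / 2 by near: k; exact: gt2.
have le2k : `|1 - subset_prob (p a' k)
   (fun S : {set G k} => (diameter R (cayley S) <= 2%:E)%E)| < 1 / 2 by near: k; exact: le2.
have {hn1} [q1 hU] := hn1 (G k) nk1.
have pE : p a k = threshold_rate (G k) a by rewrite /p; apply/min_idPr.
rewrite pE in gt2k.
have {hn3} := hn3 _ nk3; rewrite ge_max => /andP[].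
have n0 := order_gt0 R (G k).
set n : R := #|G k|%:R in n0 *; set L := ln n => Lt Lm.
have lamlt : 1 - #|sqrt1 (G k)|%:R / (2 * n) < (crat R r0.+1)^-1.
  rewrite ltNge; apply/negP => lamge.
  have b34 : (crat R r0.+1)^-1 <= 3 / 4.
    by rewrite cratV // gerBl invr_ge0 mulr_ge0 ?ler0n.
  have L0 : 0 <= L by apply: le_trans Lt; rewrite divr_ge0 // ltW.
  have : \sum_(x : G k | x != 1%g) expR (- (a * L * ((proddeg x)%:R / (2 * n)))) <= 1 / 8.
    apply: (@le_trans _ _ (\sum_(x : G k) expR (- (a * L / crat R r0.+1)))).
      rewrite [leRHS](bigID (fun x : G k => x != 1%g)) /=.
      apply: ler_wpDr; first by apply: sumr_ge0 => x _; exact: expR_ge0.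
      apply: ler_sum => x _; rewrite ler_expR lerN2.
      apply: ler_wpM2l; first by rewrite mulr_ge0 // ltW.
      exact: proddeg_ratio_ge.
    have nE : n = expR L by rewrite /L lnK ?posrE.
    rewrite sumr_const -[leLHS]mulr_natl -[X in X * _ <= _]/n nE -expRD.
    have -> : L - a * L / crat R r0.+1 = - (t * L).
      by rewrite /t; field; rewrite gt_eqF.
    rewrite expRN div1r lef_pV2 ?posrE ?expR_gt0 //.
    apply: le_trans (expR_ge1Dx _).
    by move: Lt; rewrite ler_pdivrMr // mulrC; lra.
  move=> hS; move: hU gt2k; rewrite -/n -/L ltr_distl; set u := subset_prob _ _.
  by set s := \sum_(x | _) _ in hS *; lra.
have [lamle nZ] := lam_small r00 lamlt.
have sqm : (#|center_inv (G k) :&: squares (G k)| <= m)%N.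
  apply: (@leq_trans #|squares (G k)|); first exact/subset_leq_card/finset.subsetIr.
  have Z0 : (0 < #|center_inv (G k)|)%N.
    apply/card_gt0P; exists 1%g; apply/center_invP.
    by split; [move=> y; exact: commute1|rewrite mulg1].
  rewrite -(leq_pmul2r Z0); exact: leq_trans (card_squares _) nZ.
have m0 : (0 < m)%N by rewrite muln_gt0 r00 expn_gt0 muln_gt0 r00.
have low : a' * L * (1 - #|sqrt1 (G k)|%:R / (2 * n)) <=
    ln #|center_inv (G k)|%:R - d * L.
  have Z0 : (0 : R) < #|center_inv (G k)|%:R.
    rewrite ltr0n lt0n; apply/eqP => Z0; move: nZ; rewrite Z0 muln0 leqn0 => /eqP nZ.
    by move: n0; rewrite /n ltr0n nZ.
  have lnZ : L <= ln m%:R + ln #|center_inv (G k)|%:R.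
    have mZ0 : 0 < m%:R * #|center_inv (G k)|%:R :> R by rewrite mulr_gt0 // ltr0n.
    have zN : (0 < #|center_inv (G k)|)%N by rewrite -(ltr0n R).
    rewrite -lnM ?posrE ?ltr0n // -ler_expR !lnK ?posrE //.
    by rewrite -natrM ler_nat.
  have L0 : 0 <= L by apply: le_trans Lt; rewrite divr_ge0 // ltW.
  have mL : ln m%:R <= d * L by move: Lm; rewrite ler_pdivrMr // mulrC.
  have : a' * L * (1 - #|sqrt1 (G k)|%:R / (2 * n)) <= a' * L * (crat R r0)^-1.
    by apply: ler_wpM2l lamle; rewrite mulr_ge0 // ltW.
  have dE : a' * L * (crat R r0)^-1 = L - 2 * (d * L).
    by rewrite /d; field; rewrite gt_eqF.
  by rewrite dE; lra.
have := hn2 (G k) nk2 sqm low (p a' k).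
have -> : 0 <= p a' k <= threshold_rate (G k) a'.
  by rewrite p_le; have /andP[-> _] := p01 a' k.
move=> /(_ isT); move: le2k; rewrite ltr_distl; set u := subset_prob _ _.
lra.
Unshelve. all: by end_near.
Qed.

End ThresholdNecessity.

(** * Generalized dihedral groups *)

Section GeneralizedDihedral.
Variable A : finZmodType.

(* The semidirect product of [A] by the inversion; the flag marks reflections. *)
Definition dihedral : Type := (A * bool)%type.

HB.instance Definition _ := Finite.on dihedral.

Definition dih_mul (x y : dihedral) : dihedral :=
  (x.1 + (if x.2 then - y.1 else y.1), x.2 (+) y.2).
Definition dih_one : dihedral := (0, false).
Definition dih_inv (x : dihedral) : dihedral := (if x.2 then x.1 else - x.1, x.2).

Lemma dih_mulA : associative dih_mul.
Proof.
move=> [a s] [b t] [c u]; rewrite /dih_mul /= addbA; congr (_, _).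
by case: s; case: t; rewrite /= ?opprD ?opprK addrA.
Qed.

Lemma dih_mul1 : left_id dih_one dih_mul.
Proof. by case=> a s; rewrite /dih_mul /= add0r. Qed.

Lemma dih_mulV : left_inverse dih_one dih_inv dih_mul.
Proof. by case=> a [] /=; rewrite /dih_mul /dih_one /= ?subrr ?addNr. Qed.

HB.instance Definition _ := Finite_isGroup.Build dihedral dih_mulA dih_mul1 dih_mulV.

Definition dih : finGroupType := dihedral.

Definition torsion2 : {set A} := [set a : A | a + a == 0]%SET.

Lemma dih_mulE (x y : dih) : (x * y)%g = dih_mul x y.
Proof. by []. Qed.

Lemma dih_oneE : 1%g = dih_one. Proof. by []. Qed.

Lemma card_dihedral : #|dih| = (2 * #|A|)%N.
Proof. by rewrite card_prod card_bool mulnC. Qed.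

Lemma card_dih_sqrt1 : #|sqrt1 dih| = (#|A| + #|torsion2|)%N.
Proof.
have -> : sqrt1 dih = finset.setX [set: A]%SET [set true]%SET :|: finset.setX torsion2 [set false]%SET.
  apply/setP => -[a s]; rewrite !inE /= dih_mulE dih_oneE /dih_mul /dih_one /=.
  by case: s; rewrite /= ?subrr ?eqxx //= andbT xpair_eqE andbT.
rewrite cardsU [X in (_ - #|pred_of_set X|)%N](_ : _ = finset.set0).
  by rewrite cards0 subn0 !cardsX !cards1 cardsT !muln1.
by apply/setP => -[a s]; rewrite !inE /=; case: s; rewrite ?andbF.
Qed.

Lemma torsion2_center (a : A) : a \in torsion2 -> (a, false) \in center_inv dih.
Proof.
rewrite inE => /eqP aa; apply/center_invP; split; last first.
  by rewrite dih_mulE dih_oneE /dih_mul /= aa.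
have aN : - a = a by apply/eqP; rewrite eq_sym -subr_eq0 opprK aa.
move=> [b t]; rewrite /commute !dih_mulE /dih_mul /= addbF; congr (_, _).
by case: t; rewrite ?aN addrC.
Qed.

Lemma card_center_dih_ge : (#|torsion2| <= #|center_inv dih|)%N.
Proof.
have inj : injective (fun a : A => (a, false) : dih) by move=> a b [].
rewrite -(card_imset _ inj); apply/subset_leq_card/fintype.subsetP => x /imsetP[a aT ->].
exact: torsion2_center.
Qed.

Let add_flip (a b : A) : b + a = a - b -> b + b = 0.
Proof.
by move/(congr1 (fun u => u - a + b)); rewrite /= addrK => ->; rewrite addrAC subrK subrr.
Qed.

(** An element of the base that is not 2-torsion commutes with no reflection, so the center contains
    no reflection. *)
Lemma card_center_dih_le : (#|torsion2| < #|A|)%N ->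
  (#|center_inv dih| <= #|torsion2|)%N.
Proof.
move=> TA; have [b bT] : exists b, b \notin torsion2.
  have /existsP[b bT] : [exists b, b \notin torsion2].
    apply: contraLR TA => /existsPn h; rewrite -leqNgt -cardsT.
    by apply/subset_leq_card/fintype.subsetP => b _; have := h b; rewrite negbK.
  by exists b.
have sub : center_inv dih \subset finset.setX torsion2 [set false]%SET.
  apply/fintype.subsetP => -[a s] /center_invP[aC aa]; rewrite finset.in_setX !inE /=.
  case: s aC aa => aC; rewrite dih_mulE dih_oneE /dih_mul /dih_one /=.
    have := aC (b, false); rewrite /commute !dih_mulE /dih_mul /= => -[ab] _.
    by move: bT; rewrite inE (add_flip ab) eqxx.
  by case=> ->; rewrite eqxx.
by apply: leq_trans (subset_leq_card sub) _; rewrite cardsX cards1 muln1.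
Qed.

(** A rotation outside the 2-torsion has [x^2 != 1]. A reflection is centralized only by the
    2-torsion and by its products with the reflection. *)
Lemma dih_proddeg (x : dih) : x \notin center_inv dih ->
  (2 * #|dih| <= proddeg x + 2 * #|torsion2|)%N.
Proof.
case: x => a [] xZ; last first.
  have xx : (((a, false) : dih) * ((a, false) : dih) != 1)%g.
    apply: contra xZ => /eqP; rewrite dih_mulE dih_oneE => -[aa].
    by apply: torsion2_center; rewrite inE aa.
  by apply: leq_trans (proddeg_ge2 xx) _; exact: leq_addr.
apply: leq_trans (proddeg_ge_cent ((a, true) : dih)) _; rewrite leq_add2l.
have sub : 'C[(a, true) : dih]%g \subset
    finset.setX torsion2 [set false]%SET :|:
    [set ((b + a, true) : dih) | b in torsion2]%SET.
  apply/fintype.subsetP => -[b t] /cent1P; rewrite /commute !dih_mulE /dih_mul /= => -[h _].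
  apply/setUP; case: t h => h.
    right; apply/imsetP; exists (b - a); last by rewrite subrK.
    by rewrite inE {1}h addrA subrK subrr.
  by left; rewrite finset.in_setX !inE /= andbT (add_flip h) eqxx.
apply: leq_trans (subset_leq_card sub) _; apply: leq_trans (leq_card_setU _ _) _.
by rewrite cardsX cards1 muln1 mul2n -addnn leq_add2l leq_imset_card.
Qed.

Lemma dih_square (x : dih) : x \in squares dih ->
  exists a, x = (a + a, false).
Proof.
case/imsetP => -[a s] _ ->; rewrite dih_mulE /dih_mul /= addbb.
by case: s; [exists 0; rewrite subrr addr0|exists a].
Qed.

End GeneralizedDihedral.

(** * Tuning the relative size of an elementary abelian factor *)

Section Exponents.
Variable R : realType.

Lemma expRN_ln_small (g eta : R) : 0 < g -> 0 < eta ->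
  exists n0, forall n, (n0 <= n)%N -> expR (- (g * ln (n%:R : R))) <= eta.
Proof.
move=> g0 eta0; have [n0 h] := ln_nat_large (eta^-1 / g).
exists n0 => n /h; rewrite ler_pdivrMr // mulrC => gL.
rewrite expRN -[leRHS]invrK lef_pV2 ?posrE ?expR_gt0 ?invr_gt0 //.
by apply: le_trans (expR_ge1Dx _); apply: le_trans gL _; rewrite lerDr.
Qed.

Lemma ln2_gt0 : 0 < ln 2 :> R.
Proof. by rewrite ln_gt0 // ltr1n. Qed.

Lemma ln2_le1 : ln 2 <= 1 :> R.
Proof. by rewrite -[2]/(1 + 1); apply: le_ln1Dx; rewrite (lt_trans _ ltr01) // oppr_lt0. Qed.

Lemma dyadic_exponent (t : nat -> nat) (b : R) : (forall k, k < t k)%N ->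
  0 < b <= 1 -> exists a : nat -> nat, forall d, 0 < d -> exists k0, forall k, (k0 <= k)%N ->
  `|(a k)%:R * ln 2 - b * ((a k)%:R * ln 2 + ln (t k)%:R)| <=
    d * ((a k)%:R * ln 2 + ln (t k)%:R).
Proof.
move=> tk /andP[b0 b1]; have l2 := ln2_gt0; have l21 := ln2_le1.
have t1 k : 1 <= (t k)%:R :> R by rewrite ler1n; exact: leq_ltn_trans (tk k).
have lt0 k : 0 <= ln (t k)%:R :> R by exact: ln_ge0.
have [->|bn1] := eqVneq b 1.
  (* For [b = 1] the exponent [a] only has to outgrow [ln t]. *)
  exists (fun k => k * t k)%N => d d0.
  exists (Num.truncn ((d * ln 2)^-1)).+1 => k hk.
  have hk' : (d * ln 2)^-1 <= k%:R.
    by apply/ltW; apply: lt_le_trans (truncnS_gt _) _; rewrite ler_nat.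
  rewrite mul1r opprD addNKr normrN ger0_norm //.
  have h1 : ln (t k)%:R <= (t k)%:R :> R.
    have := le_ln1Dx (x := (t k)%:R - 1 : R); rewrite [1 + _]addrC subrK => h.
    by apply: le_trans (h _) _; have := t1 k; lra.
  have h2 : 1 <= d * (k%:R * ln 2).
    by rewrite mulrCA -ler_pdivrMr ?mulr_gt0 // div1r.
  apply: (le_trans h1); rewrite natrM mulrDr; apply: ler_wpDr.
    by rewrite mulr_ge0 // ltW.
  have -> : d * (k%:R * (t k)%:R * ln 2) = d * (k%:R * ln 2) * (t k)%:R by ring.
  by rewrite -[leLHS]mul1r ler_wpM2r.
have {bn1} b1 : b < 1 by rewrite lt_neqAle bn1.
(* The exact solution of [a ln 2 = b (a ln 2 + ln t)] is [a ln 2 = s ln t]; truncation changes it by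
   at most [ln 2]. *)
pose s := b / (1 - b).
have b10 : 0 < 1 - b by lra.
have s0 : 0 < s by exact: divr_gt0.
exists (fun k => Num.truncn (s * ln (t k)%:R / ln 2)) => d d0.
have [n0 hn0] := ln_nat_large d^-1; exists n0 => k hk.
set a := (Num.truncn _)%:R; set l := ln (t k)%:R.
have x0 : 0 <= s * l / ln 2 by exact: (divr_ge0 (mulr_ge0 (ltW s0) (lt0 k)) (ltW l2)).
have /andP[a1 a2] := truncn_itv x0.
have {a1} a1 : a * ln 2 <= s * l by rewrite -ler_pdivlMr.
have {a2} a2 : s * l <= a * ln 2 + ln 2.
  by move: a2; rewrite ltr_pdivrMr // -natr1 mulrDl mul1r => /ltW.
have dl : 1 <= d * l.
  have /hn0 : (n0 <= t k)%N by exact: leq_trans hk (ltnW (tk k)).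
  by rewrite -/l mulrC -ler_pdivrMr // div1r.
have -> : a * ln 2 - b * (a * ln 2 + l) = (1 - b) * (a * ln 2 - s * l).
  by rewrite /s; field; rewrite gt_eqF.
have a0 : 0 <= a * ln 2 by rewrite mulr_ge0 ?ler0n // ltW.
apply: (@le_trans _ _ 1); last first.
  by apply: (le_trans dl); rewrite ler_wpM2l ?(ltW d0) // lerDr.
rewrite normrM ger0_norm ?(ltW b10) // -[leRHS]mul1r; apply: ler_pM => //.
- exact: ltW.
- by rewrite gerBl ltW.
- by rewrite ler_norml; apply/andP; split; lra.
Qed.

End Exponents.

(* Product types have no [finZmodType] instance without this. *)
HB.saturate prod.

(** * Dihedral families with thresholds in [1, 4/3] or of the form [crat r] *)

Section DihedralFamilies.
Variable R : realType.

(** The cyclic factor has order [2 (r + 1)], hence the shift from [r] to [crat r.+1]: here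
    [i - n / 2 = 2^(a+1)] and [n = 2^a * 4 (r + 1)]. *)
Definition dih_base (a r : nat) : finZmodType := ('rV['F_2]_a * 'I_(r.*2.+2))%type.

Lemma rowF2_double (a : nat) (v : 'rV['F_2]_a) : v + v = 0.
Proof.
apply/matrixP => i j; rewrite !mxE; apply: addrr_pchar2.
exact: (@pchar_Fp 2).
Qed.

Lemma ord_double (r : nat) (y : 'I_(r.*2.+2)) : (y + y == 0) = (y == 0) || (val y == r.+1).
Proof.
rewrite -!val_eqE /=; have yl := ltn_ord y.
apply/eqP/orP => [h|[]/eqP->]; last 2 first.
- by rewrite mod0n.
- by rewrite (_ : (r.+1 + r.+1 = r.*2.+2)%N) ?modnn //; lia.
have [y0|y0] := posnP (nat_of_ord y); [by left; apply/eqP|right].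
have := divn_eq (y + y) r.*2.+2; rewrite h addn0 => e.
have : ((y + y) %/ r.*2.+2 < 2)%N by rewrite ltn_divLR //; lia.
by move: e; case: (_ %/ _)%N => [|[|]] // e _; apply/eqP; move: e; rewrite ?mul0n ?mul1n; lia.
Qed.

Lemma card_dih_base (a r : nat) : #|dih_base a r| = (2 ^ a * r.*2.+2)%N.
Proof. by rewrite card_prod card_mx card_Fp // mul1n card_ord. Qed.

Lemma card_torsion2_base (a r : nat) : #|torsion2 (dih_base a r)| = (2 ^ a * 2)%N.
Proof.
have r1 : (r.+1 < r.*2.+2)%N by lia.
have -> : torsion2 (dih_base a r) =
    finset.setX [set: 'rV['F_2]_a]%SET [set 0; Ordinal r1]%SET.
  apply/setP => -[v y]; rewrite !inE /= -[_ + _]/(v + v, y + y) xpair_eqE.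
  by rewrite rowF2_double eqxx ord_double -val_eqE.
by rewrite cardsX cardsT card_mx card_Fp // mul1n cards2.
Qed.

Local Notation D a r := (dih (dih_base a r)).

Lemma card_dih_family (a r : nat) : #|D a r| = (2 ^ a * (4 * r.+1))%N.
Proof. by rewrite card_dihedral card_dih_base; lia. Qed.

Lemma dih_family_lam (a r : nat) :
  1 - #|sqrt1 (D a r)|%:R / (2 * #|D a r|%:R) = (crat R r.+1)^-1.
Proof.
rewrite cratV // card_dih_sqrt1 card_dih_family card_dih_base card_torsion2_base.
have -> : (2 ^ a * r.*2.+2 + 2 ^ a * 2 = 2 ^ a * (2 * r.+1 + 2))%N by lia.
rewrite !natrM natrD natrM; field.
by rewrite -[1]/(1%:R) -natrD !pnatr_eq0 expn_eq0.
Qed.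

(** Squares are doubles in the base, so the elementary abelian part vanishes and a square that
    squares to 1 is one of the two 2-torsion elements of the cyclic part. *)
Lemma dih_family_squares (a r : nat) :
  (#|center_inv (D a r) :&: squares (D a r)| <= 2)%N.
Proof.
have r1 : (r.+1 < r.*2.+2)%N by lia.
have sub : center_inv (D a r) :&: squares (D a r) \subset
    finset.setX (finset.setX [set 0] [set 0; Ordinal r1]) [set false]%SET.
  apply/fintype.subsetP => x /setIP[/center_invP[_ xx] /dih_square[[v y] xE]].
  have vv := rowF2_double v; rewrite xE in xx *.
  have : y + y + (y + y) == 0.
    by apply/eqP; exact: (congr1 (fun u : dihedral (dih_base a r) => u.1.2) xx).
  rewrite ord_double => yy; rewrite -[_ + _]/(v + v, y + y) vv.
  by rewrite !finset.in_setX !finset.in_set1 finset.in_set2 !eqxx andbT.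
apply: leq_trans (subset_leq_card sub) _.
by rewrite !cardsX !cards1 cards2 mul1n muln1; case: (_ != _).
Qed.

Lemma dih_family_center_ge (a r : nat) : (2 ^ a * 2 <= #|center_inv (D a r)|)%N.
Proof. by rewrite -(card_torsion2_base a r) card_center_dih_ge. Qed.

Local Open Scope classical_set_scope.
Local Open Scope ring_scope.

(** The cyclic factor is fixed and the elementary abelian one grows, so [lam] is constant and
    [center_inv] has bounded index. *)
Lemma crat_realized (r : nat) : (0 < r)%N ->
  exists G : nat -> finGroupType,
    (#|G k| @[k --> \oo] --> \oo) /\ is_diam2_threshold G (crat R r).
Proof.
case: r => // r _; pose G k : finGroupType := D k r; exists G.
have Glarge n0 : \forall k \near \oo, (n0 <= #|G k|)%N.
  exists n0 => // k /= hk; rewrite /G card_dih_family.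
  apply: leq_trans hk (leq_trans (ltnW (ltn_expl k (ltnSn 1))) _).
  by rewrite leq_pmulr.
have Goo : #|G k| @[k --> \oo] --> \oo by apply/cvgnyPge.
split=> //; have c0 : 0 < crat R r.+1 by exact: crat_gt0.
apply: (@threshold_criterion R G _ 2) => // [k|a /andP[a0 ac]|a ac eta eta0].
- exact: dih_family_squares.
- pose d := (1 - a / crat R r.+1) / 2.
  have d0 : 0 < d by rewrite divr_gt0 // subr_gt0 ltr_pdivrMr // mul1r.
  exists d => //.
  have [n0 hn0] := ln_nat_large (ln ((2 * r.+1)%:R : R) / d).
  near=> k.
  have /hn0 : (n0 <= #|G k|)%N by near: k; exact: Glarge.
  rewrite ler_pdivrMr // mulrC dih_family_lam => hL.
  have lnZ : ln #|G k|%:R <= ln ((2 * r.+1)%:R : R) + ln #|center_inv (G k)|%:R.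
    have Z0 : (0 < #|center_inv (G k)|)%N.
      by apply: leq_trans (dih_family_center_ge k r); rewrite muln_gt0 expn_gt0.
    have n0' := order_gt0 R (G k).
    rewrite -lnM ?posrE ?ltr0n // -natrM -ler_expR !lnK ?posrE ?ltr0n ?muln_gt0 //.
      rewrite ler_nat /G card_dih_family.
      apply: (@leq_trans (2 * r.+1 * (2 ^ k * 2))); first by lia.
      by rewrite leq_mul2l dih_family_center_ge.
    by move: n0'; rewrite ltr0n.
  have -> : a * ln #|G k|%:R * (crat R r.+1)^-1 = ln #|G k|%:R - 2 * (d * ln #|G k|%:R).
    by rewrite /d; field; rewrite gt_eqF.
  by lra.
pose g := a / crat R r.+1 - 1.
have g0 : 0 < g by rewrite subr_gt0 ltr_pdivlMr // mul1r.
have [n0 hn0] := expRN_ln_small g0 eta0.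
near=> k.
have nk : (maxn n0 1 <= #|G k|)%N by near: k; exact: Glarge.
move: nk; rewrite geq_max => /andP[/hn0 small n1].
apply: le_trans small.
set n : R := #|G k|%:R; set L := ln n.
have n_gt0 : 0 < n by exact: order_gt0.
have L0 : 0 <= L by rewrite ln_ge0 // ler1n.
apply: (@le_trans _ _ (\sum_(x : G k) expR (- (a * L / crat R r.+1)))).
  rewrite [leRHS](bigID (fun x : G k => x != 1%g)) /=.
  apply: ler_wpDr; first by apply: sumr_ge0 => x _; exact: expR_ge0.
  apply: ler_sum => x _; rewrite ler_expR lerN2.
  apply: ler_wpM2l; first by rewrite mulr_ge0 // ltW // (lt_trans c0).
  apply: proddeg_ratio_ge; last by rewrite dih_family_lam.
  by rewrite cratV // gerBl invr_ge0 mulr_ge0 ?ler0n.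
have nE : n = expR L by rewrite /L lnK ?posrE.
rewrite sumr_const -[leLHS]mulr_natl -[X in X * _ <= _]/n nE -expRD ler_expR.
by rewrite /g le_eqVlt; apply/orP; left; apply/eqP; field; rewrite gt_eqF.
Unshelve. all: by end_near.
Qed.

(** Here the cyclic factor grows too, so [lam] tends to 3/4, while [center_inv] is tuned to about
    [n^(3 c / 4)] elements: its first moment is about [n^(3 (c - a) / 4)]. The noncentral elements
    contribute at most about [n^(1 - a)], which is why [c >= 1] is required. *)
Lemma dih_interval_realized (c : R) : 1 <= c <= 4 / 3 ->
  exists G : nat -> finGroupType,
    (#|G k| @[k --> \oo] --> \oo) /\ is_diam2_threshold G c.
Proof.
move=> /andP[c1 c43]; have c0 : 0 < c by lra.
have tk k : (k < 4 * k.+1)%N by lia.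
have b01 : 0 < 3 / 4 * c <= 1 by lra.
have [dim hdim] := dyadic_exponent tk b01.
pose G k : finGroupType := D (dim k) k; exists G.
have cG k : #|G k| = (2 ^ dim k * (4 * k.+1))%N by exact: card_dih_family.
have Glarge n0 : \forall k \near \oo, (n0 <= #|G k|)%N.
  exists n0 => // k /= hk; rewrite cG; apply: leq_trans hk (leq_trans (ltnW (tk k)) _).
  by rewrite leq_pmull // expn_gt0.
have Goo : #|G k| @[k --> \oo] --> \oo by apply/cvgnyPge.
have lnG k : ln (#|G k|%:R) = (dim k)%:R * ln 2 + ln (4 * k.+1)%:R :> R.
  rewrite cG natrM lnM ?posrE ?ltr0n ?expn_gt0 // natrX lnXn ?ltr0n //.
  by rewrite mulr_natl.
have close d : 0 < d -> \forall k \near \oo,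
    `|(dim k)%:R * ln 2 - 3 / 4 * c * ln (#|G k|%:R)| <= d * ln (#|G k|%:R) :> R.
  by move=> d0; have [k0 h] := hdim d d0; exists k0 => // k /= /h; rewrite -lnG.
have l2 := ln2_gt0 R; have l21 := ln2_le1 R.
split=> //; apply: (@threshold_criterion R G _ 2) => // [k|a /andP[a0 ac]|a ac eta eta0].
- exact: dih_family_squares.
- pose d := 3 / 8 * (c - a); have d0 : 0 < d by rewrite mulr_gt0 // subr_gt0.
  exists d => //; near=> k.
  have : `|(dim k)%:R * ln 2 - 3 / 4 * c * ln (#|G k|%:R)| <= d * ln (#|G k|%:R) :> R.
    by near: k; exact: close.
  rewrite ler_norml => /andP[lo _].
  rewrite dih_family_lam.
  have L0 : 0 <= ln (#|G k|%:R) :> R.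
    by rewrite ln_ge0 // ler1n -(ltr0n R) order_gt0.
  have lnZ : (dim k)%:R * ln 2 <= ln #|center_inv (G k)|%:R :> R.
    have Z := dih_family_center_ge (dim k) k.
    have Z0 : (0 < #|center_inv (G k)|)%N.
      by apply: leq_trans Z; rewrite muln_gt0 expn_gt0.
    rewrite -ler_expR lnK ?posrE ?ltr0n // expRM_natl lnK ?posrE // -natrX ler_nat.
    by apply: leq_trans Z; rewrite leq_pmulr.
  have : a * ln (#|G k|%:R) * (crat R k.+1)^-1 <= a * ln (#|G k|%:R) * (3 / 4).
    apply: ler_wpM2l; first by rewrite mulr_ge0 // ltW.
    by rewrite cratV // gerBl invr_ge0 mulr_ge0 ?ler0n.
  by move: lo; rewrite /d; set L := ln _; lra.
pose g := a - c; have g0 : 0 < g by rewrite subr_gt0.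
have g4 : 0 < g / 4 by rewrite divr_gt0.
have eta2 : 0 < eta / 2 by rewrite divr_gt0.
have [n1 hn1] := expRN_ln_small g4 eta2.
have [n2 hn2] := ln_nat_large (8 / g).
have a0 : 0 < a by exact: lt_trans ac.
near=> k.
have nk1 : (n1 <= #|G k|)%N by near: k; exact: Glarge.
have nk2 : (n2 <= #|G k|)%N by near: k; exact: Glarge.
(* For [k = 0] the base would be entirely 2-torsion and [card_center_dih_le] would not apply. *)
have k1 : (1 <= k)%N by near: k; exists 1%N.
have kr : 2 * a / g <= k.+1%:R.
  apply: le_trans (ltW (truncnS_gt _)) _; rewrite ler_nat ltnS.
  by near: k; exists (Num.truncn (2 * a / g)).
have : `|(dim k)%:R * ln 2 - 3 / 4 * c * ln (#|G k|%:R)| <= g / 4 * ln (#|G k|%:R) :> R.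
  by near: k; exact: close.
rewrite ler_norml => /andP[_ hi].
have {hn1} := hn1 _ nk1; have {hn2} := hn2 _ nk2.
set n : R := #|G k|%:R in hi *; set L := ln n in hi *.
move=> L8 small.
have gL : 1 <= g / 8 * L.
  by move: L8; rewrite ler_pdivrMr // => L8; clear -L8; lra.
have n_gt0 : 0 < n by exact: order_gt0.
have L0 : 0 <= L by apply: le_trans L8; rewrite divr_ge0 // ltW.
have r0 : 0 < k.+1%:R :> R by rewrite ltr0n.
have ar : a / (2 * k.+1%:R) <= g / 4.
  move: kr; rewrite ler_pdivrMr // ler_pdivrMr ?mulr_gt0 //; clear; lra.
have [u uE] : exists u : R, u = a / (2 * k.+1%:R) * L by eexists.
have arL : u <= g / 4 * L by rewrite uE; exact: ler_wpM2r.
have bound : \sum_(x : G k | x != 1%g) expR (- (a * L * ((proddeg x)%:R / (2 * n)))) <=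
    #|center_inv (G k)|%:R * expR (- (a * L * (crat R k.+1)^-1)) +
    n * expR (- (a * L * (1 - (2 * k.+1%:R)^-1))).
  have -> : n * expR (- (a * L * (1 - (2 * k.+1%:R)^-1))) =
      \sum_(x : G k) expR (- (a * L * (1 - (2 * k.+1%:R)^-1))).
    by rewrite sumr_const -[RHS]mulr_natl.
  have -> : #|center_inv (G k)|%:R * expR (- (a * L * (crat R k.+1)^-1)) =
      \sum_(x in center_inv (G k)) expR (- (a * L * (crat R k.+1)^-1)).
    by rewrite sumr_const -[RHS]mulr_natl.
  rewrite [X in _ <= X + _]big_mkcond -big_split /= [leLHS]big_mkcond /=.
  apply: ler_sum => x _; case: ifP => _; last first.
    by case: ifP => _; rewrite ?add0r ?addr_ge0 ?expR_ge0.
  have aL0 : 0 <= a * L by rewrite mulr_ge0 // ltW.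
  case: ifP => xZ.
    by rewrite (proddeg_lam R xZ) dih_family_lam lerDl expR_ge0.
  rewrite add0r ler_expR lerN2; apply: ler_wpM2l => //.
  have := dih_proddeg (negbT xZ); rewrite card_torsion2_base.
  rewrite -[#|_|]/#|G k| -(ler_nat R) natrD !natrM -/n => h.
  have nk : n = 2 ^+ dim k * (4 * k.+1%:R) :> R by rewrite /n cG !natrM natrX.
  rewrite ler_pdivlMr ?mulr_gt0 //.
  have -> : (1 - (2 * k.+1%:R)^-1) * (2 * n) = 2 * n - 2 * (2 ^+ dim k * 2).
    by rewrite nk; field; rewrite gt_eqF.
  by move: h; rewrite natrX; clear; lra.
apply: (le_trans bound).
have TA : (#|torsion2 (dih_base (dim k) k)| < #|dih_base (dim k) k|)%N.
  rewrite card_torsion2_base card_dih_base ltn_pmul2l ?expn_gt0 //.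
  by clear -k1; lia.
have Zle : #|center_inv (G k)|%:R <= expR ((dim k)%:R * ln 2 + ln 2) :> R.
  rewrite expRD expRM_natl lnK ?posrE // -natrX -natrM ler_nat.
  by rewrite -(card_torsion2_base (dim k) k) card_center_dih_le.
have nE : n = expR L by rewrite /L lnK ?posrE.
have b1 : #|center_inv (G k)|%:R * expR (- (a * L * (crat R k.+1)^-1)) <=
    expR (- (g / 4 * L)).
  apply: le_trans (ler_wpM2r (expR_ge0 _) Zle) _; rewrite -expRD ler_expR cratV //.
  have -> : a * L * (3 / 4 - (4 * k.+1%:R)^-1) =
      3 / 4 * a * L - u / 2 by rewrite uE; field; rewrite gt_eqF.
  by move: hi arL gL l21; rewrite /g; clear; lra.
have b2 : n * expR (- (a * L * (1 - (2 * k.+1%:R)^-1))) <= expR (- (g / 4 * L)).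
  rewrite nE -expRD ler_expR.
  have -> : a * L * (1 - (2 * k.+1%:R)^-1) = a * L - u.
    by rewrite uE; field; rewrite gt_eqF.
  have : L <= c * L by rewrite ler_peMl.
  by move: arL gL; rewrite /g; clear; lra.
by move: b1 b2 small; clear; lra.
Unshelve. all: by end_near.
Qed.

End DihedralFamilies.

(** * Heisenberg groups *)

Section Heisenberg.
Variables (V : finZmodType) (F : finFieldType).

(* The direct product of [V] and of the unitriangular 3 x 3 matrices over [F];
   [(v, a, b, c)] carries the matrix entries [a] and [b] next to the diagonal
   and the corner entry [c]. *)
Definition heisenberg : Type := (V * F * F * F)%type.

HB.instance Definition _ := Finite.on heisenberg.

Definition heis_v (x : heisenberg) : V := x.1.1.1.
Definition heis_a (x : heisenberg) : F := x.1.1.2.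
Definition heis_b (x : heisenberg) : F := x.1.2.
Definition heis_c (x : heisenberg) : F := x.2.

Definition heis_mul (x y : heisenberg) : heisenberg :=
  (heis_v x + heis_v y, heis_a x + heis_a y, heis_b x + heis_b y,
   heis_c x + heis_c y + heis_a x * heis_b y).
Definition heis_one : heisenberg := (0, 0, 0, 0).
Definition heis_inv (x : heisenberg) : heisenberg :=
  (- heis_v x, - heis_a x, - heis_b x, - heis_c x + heis_a x * heis_b x).

Lemma heis_mulA : associative heis_mul.
Proof.
move=> [[[v a] b] c] [[[v' a'] b'] c'] [[[v'' a''] b''] c''].
rewrite /heis_mul /heis_v /heis_a /heis_b /heis_c /= !addrA.
by congr (_, _, _, _); ring.
Qed.

Lemma heis_mul1 : left_id heis_one heis_mul.
Proof.
move=> [[[v a] b] c]; rewrite /heis_mul /heis_v /heis_a /heis_b /heis_c /=.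
by rewrite mul0r addr0 !add0r.
Qed.

Lemma heis_mulV : left_inverse heis_one heis_inv heis_mul.
Proof.
move=> [[[v a] b] c].
rewrite /heis_mul /heis_one /heis_inv /heis_v /heis_a /heis_b /heis_c /= !addNr.
by congr (_, _, _, _); ring.
Qed.

HB.instance Definition _ := Finite_isGroup.Build heisenberg heis_mulA heis_mul1 heis_mulV.

Definition heis : finGroupType := heisenberg.

Hypothesis V2 : forall v : V, v + v = 0.
Hypothesis F2 : (1 + 1 : F) != 0.

Let double_eq0 (u : F) : (u + u == 0) = (u == 0).
Proof.
have -> : u + u = (1 + 1) * u by rewrite mulrDl mul1r.
by rewrite mulf_eq0 (negPf F2).
Qed.

Let neg_self (u : F) : u = - u -> u = 0.
Proof. by move=> e; apply/eqP; rewrite -double_eq0 {1}e addNr. Qed.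

Lemma heis_aM (x y : heis) : heis_a (x * y)%g = heis_a x + heis_a y. Proof. by []. Qed.
Lemma heis_bM (x y : heis) : heis_b (x * y)%g = heis_b x + heis_b y. Proof. by []. Qed.
Lemma heis_cM (x y : heis) :
  heis_c (x * y)%g = heis_c x + heis_c y + heis_a x * heis_b y. Proof. by []. Qed.
Lemma heis_aV (x : heis) : heis_a (x^-1)%g = - heis_a x. Proof. by []. Qed.
Lemma heis_bV (x : heis) : heis_b (x^-1)%g = - heis_b x. Proof. by []. Qed.

Lemma heis_commute (x y : heis) : (x * y == y * x)%g -> heis_a x * heis_b y = heis_a y * heis_b x.
Proof.
move/eqP/(congr1 heis_c); rewrite !heis_cM.
by rewrite [heis_c y + _]addrC => /addrI.
Qed.

Lemma heis_sqr_neq1 (x : heis) :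
  (heis_a x != 0) || (heis_b x != 0) || (heis_c x != 0) -> (x * x != 1)%g.
Proof.
move=> xN; apply/negP => /eqP xx.
have a0 : heis_a x = 0.
  by apply/eqP; rewrite -double_eq0; apply/eqP; exact: (congr1 heis_a xx).
have b0 : heis_b x = 0.
  by apply/eqP; rewrite -double_eq0; apply/eqP; exact: (congr1 heis_b xx).
have c0 : heis_c x = 0.
  apply/eqP; rewrite -double_eq0; apply/eqP.
  by have := congr1 heis_c xx; rewrite heis_cM a0 mul0r addr0.
by rewrite a0 b0 c0 eqxx in xN.
Qed.

(** Four candidates have first coordinate [heis_a y + heis_a x] or [heis_a y - heis_a x], and the
    other four are their inverses. A coincidence across the two groups forces one of the excluded
    values of [heis_a y], as 2 is invertible; within a group, noncommutation and [x != x^-1]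
    separate them. *)
Lemma heis_candidates8 (x y : heis) :
  (heis_a x != 0) || (heis_b x != 0) ->
  heis_a y != 0 -> heis_a y != heis_a x -> heis_a y != - heis_a x ->
  heis_a x * heis_b y != heis_a y * heis_b x ->
  (8 <= #|[set z in candidates x y]%SET|)%N.
Proof.
move=> xN y0 y1 y2 yC; apply: (card_candidates_ge (s := candidates x y)) => //.
have xx : (x * x != 1)%g by apply: heis_sqr_neq1; rewrite xN.
have xV : (x != x^-1)%g by rewrite eq_sym eq_invg_mul.
pose B := [:: y * x; x * y; y * x^-1; x^-1 * y]%g.
have cE : candidates x y = B ++ map (fun z : heis => z^-1)%g (rev B).
  by rewrite /candidates /= !invMg !invgK.
have xyC : (x * y != y * x)%g by apply: contra yC => /heis_commute ->.
have inverted : (y * x != x^-1 * y)%g /\ (x * y != y * x^-1)%g.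
  split; apply: contraTneq xN => e.
    move: (congr1 heis_a e) (congr1 heis_b e).
    rewrite !heis_aM !heis_bM !heis_aV !heis_bV addrC [heis_b y + _]addrC.
    by move/addIr => ea /addIr eb; rewrite (neg_self ea) (neg_self eb) eqxx.
  move: (congr1 heis_a e) (congr1 heis_b e).
  rewrite !heis_aM !heis_bM !heis_aV !heis_bV addrC [heis_b x + _]addrC.
  by move/addrI => ea /addrI eb; rewrite (neg_self ea) (neg_self eb) eqxx.
have uB : uniq B.
  rewrite /= !inE !negb_or (eq_sym (y * x)%g (x * y)%g) xyC.
  rewrite (inj_eq (mulgI y)) xV (inj_eq (mulIg y)) xV !(proj1 inverted) !(proj2 inverted) /=.
  rewrite andbT; apply: contra xyC => /eqP e; apply/eqP.
  by apply: (mulgI x^-1%g); apply: (mulIg x^-1%g); rewrite mulKg -!mulgA mulgV mulg1 e.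
rewrite cE cat_uniq uB (map_inj_uniq (@invg_inj heis)) rev_uniq uB andbT andTb.
apply/hasPn => z /mapP[w]; rewrite mem_rev => wB ->; apply/negP => zB.
have hB u : u \in B -> (heis_a u == heis_a y + heis_a x) || (heis_a u == heis_a y - heis_a x).
  rewrite !inE => /or4P[] /eqP ->; rewrite !heis_aM ?heis_aV ?eqxx ?orbT //.
    by rewrite addrC eqxx.
  by rewrite [- _ + _]addrC eqxx orbT.
have := hB _ wB; have := hB _ zB; rewrite heis_aV.
have ne1 : heis_a y + heis_a x != 0 by rewrite addr_eq0.
have ne2 : heis_a y - heis_a x != 0 by rewrite subr_eq0.
case/orP => /eqP h1 /orP[] /eqP h2; move: h1; rewrite h2 => /esym/eqP.
- by rewrite -subr_eq0 opprK double_eq0 (negPf ne1).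
- by rewrite -subr_eq0 opprK addrACA subrr addr0 double_eq0 (negPf y0).
- by rewrite -subr_eq0 opprK addrACA addNr addr0 double_eq0 (negPf y0).
- by rewrite -subr_eq0 opprK double_eq0 (negPf ne2).
Qed.

(** The sign of the first coordinate tells [y] from [y^-1] in these words, and [x != x^-1] does the
    rest. *)
Lemma heis_candidates4 (x y : heis) : heis_a x = 0 -> heis_c x != 0 -> heis_a y != 0 ->
  (4 <= #|[set z in candidates x y]%SET|)%N.
Proof.
move=> x0 xc y0.
have xx : (x * x != 1)%g by apply: heis_sqr_neq1; rewrite xc orbT.
have xV : (x != x^-1)%g by rewrite eq_sym eq_invg_mul.
apply: (card_candidates_ge (s := [:: y * x; y * x^-1; y^-1 * x; y^-1 * x^-1]%g)); last first.
  by move=> z; rewrite !inE => /or4P[] ->; rewrite ?orbT.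
have ne (u w : heis) : heis_a u = heis_a y -> heis_a w = - heis_a y -> u != w.
  move=> hu hw; apply: contraNneq y0 => uw.
  by rewrite -double_eq0 -{1}hu uw hw addNr.
have ap (u : heis) : heis_a u = 0 -> heis_a (y * u)%g = heis_a y.
  by move=> u0; rewrite heis_aM u0 addr0.
have an (u : heis) : heis_a u = 0 -> heis_a (y^-1 * u)%g = - heis_a y.
  by move=> u0; rewrite heis_aM heis_aV u0 addr0.
have xV0 : heis_a (x^-1)%g = 0 by rewrite heis_aV x0 oppr0.
rewrite /= !inE !negb_or !(inj_eq (mulgI _)) xV /=.
by rewrite !ne ?ap ?an.
Qed.

Lemma heis_candidates2 (x y : heis) : heis_a y != 0 ->
  (2 <= #|[set z in candidates x y]%SET|)%N.
Proof.
move=> y0; apply: (card_candidates_ge (s := [:: y * x; y^-1 * x]%g)); last first.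
  by move=> z; rewrite !inE => /orP[] ->; rewrite ?orbT.
rewrite /= inE andbT (inj_eq (mulIg _)); apply: contraNneq y0 => yV.
by rewrite -double_eq0 {1}yV heis_aV addNr.
Qed.

Lemma card_heis : #|heis| = (#|V| * #|F| ^ 3)%N.
Proof. by rewrite !card_prod !expnS expn0 muln1 !mulnA. Qed.

Local Notation m := (#|V| * #|F| ^ 2)%N.

Lemma card_heis_a (e : F) : (#|[set y : heis | heis_a y == e]%SET| <= m)%N.
Proof.
pose f (y : heis) : V * F * F := (heis_v y, heis_b y, heis_c y).
have f_inj : {in [set y : heis | heis_a y == e]%SET &, injective f}.
  move=> [[[v a] b] c] [[[v' a'] b'] c']; rewrite !inE /heis_a /= => /eqP-> /eqP->.
  by rewrite /f /heis_v /heis_b /heis_c /= => -[-> -> ->].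
rewrite -(card_in_imset f_inj); apply: leq_trans (max_card _) _.
by rewrite !card_prod expnS expn1 mulnA.
Qed.

Lemma card_heis_cent (x : heis) : (heis_a x != 0) || (heis_b x != 0) ->
  (#|[set y : heis | (heis_a x * heis_b y == heis_a y * heis_b x)%R]%SET| <= m)%N.
Proof.
have [a0 /= b0|a0 _] := eqVneq (heis_a x) 0.
  apply: leq_trans (card_heis_a 0); apply/subset_leq_card/fintype.subsetP => y.
  by rewrite !inE a0 mul0r eq_sym mulf_eq0 (negPf b0) orbF.
pose f (y : heis) : V * F * F := (heis_v y, heis_a y, heis_c y).
have f_inj : {in [set y : heis | heis_a x * heis_b y == heis_a y * heis_b x]%SET &, injective f}.
  move=> [[[v a] b] c] [[[v' a'] b'] c']; rewrite !inE => /eqP e /eqP e' -[ev ea ec].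
  move: e e'; rewrite /heis_v /heis_a /heis_b /heis_c /= in ev ea ec *.
  rewrite ev ea ec => <- /(mulfI a0) ->.
  by [].
rewrite -(card_in_imset f_inj); apply: leq_trans (max_card _) _.
by rewrite !card_prod expnS expn1 mulnA.
Qed.

(** The exceptional [y] lie in four sets of size at most [m], a fraction [1 / #|F|] of the group:
    three values of [heis_a y] and the solutions of the commutation equation. *)
Lemma proddeg_heis_noncentral (x : heis) : (heis_a x != 0) || (heis_b x != 0) ->
  (8 * (#|heis| - 4 * m) <= proddeg x)%N.
Proof.
move=> xN.
pose E e := [set y : heis | heis_a y == e]%SET.
pose K := [set y : heis | heis_a x * heis_b y == heis_a y * heis_b x]%SET.
pose bad := E 0 :|: E (heis_a x) :|: E (- heis_a x) :|: K.
have cbad : (#|bad| <= 4 * m)%N.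
  rewrite /bad; apply: leq_trans (leq_card_setU _ _) _.
  rewrite [leqRHS](_ : _ = (m + m + m) + m)%N; last by lia.
  apply: leq_add; last exact: card_heis_cent.
  apply: leq_trans (leq_card_setU _ _) _; apply: leq_add (card_heis_a _).
  by apply: leq_trans (leq_card_setU _ _) _; apply: leq_add; exact: card_heis_a.
apply: (@leq_trans (8 * #|~: bad|)%N).
  by rewrite leq_mul2l /= leq_subLR -(cardsC bad) leq_add2r.
apply: proddeg_ge => y; rewrite !inE !negb_or -!andbA => /and4P[y0 y1 y2 yC].
exact: heis_candidates8.
Qed.

Lemma card_heis_a_neq0 : (#|heis| - m <= #|[set y : heis | heis_a y != 0%R]%SET|)%N.
Proof.
rewrite leq_subLR -(cardsC [set y : heis | heis_a y == 0%R]%SET); apply: leq_add.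
  exact: card_heis_a.
by apply/subset_leq_card/fintype.subsetP => y; rewrite !inE.
Qed.

Lemma proddeg_heis_corner (x : heis) : heis_a x = 0 -> heis_c x != 0 ->
  (4 * (#|heis| - m) <= proddeg x)%N.
Proof.
move=> x0 xc; apply: leq_trans (leq_mul (leqnn 4) card_heis_a_neq0) _.
by apply: proddeg_ge => y; rewrite inE; exact: heis_candidates4.
Qed.

Lemma proddeg_heis_ge (x : heis) : (2 * (#|heis| - m) <= proddeg x)%N.
Proof.
apply: leq_trans (leq_mul (leqnn 2) card_heis_a_neq0) _.
by apply: proddeg_ge => y; rewrite inE; exact: heis_candidates2.
Qed.

Lemma card_heis_center_ge : (#|V| <= #|center_inv heis|)%N.
Proof.
have inj : injective (fun v : V => (v, 0, 0, 0) : heis) by move=> a b [].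
rewrite -(card_imset _ inj); apply/subset_leq_card/fintype.subsetP => x /imsetP[v _ ->].
apply/center_invP; split=> [[[[w a] b] c]|].
  rewrite /commute; apply: (congr2 (fun u w : _ => (u, w))).
    apply: (congr2 (fun u w : _ => (u, w))); [|exact: addrC].
    by apply: (congr2 (fun u w : _ => (u, w))); exact: addrC.
  by rewrite /heis_a /heis_b /heis_c /= mulr0 mul0r !addr0 add0r.
apply: (congr2 (fun u w : _ => (u, w))).
  apply: (congr2 (fun u w : _ => (u, w))); [|exact: addr0].
  by apply: (congr2 (fun u w : _ => (u, w))); [exact: V2|exact: addr0].
by rewrite /heis_a /heis_b /heis_c /= mulr0 !addr0.
Qed.

(** A square has trivial [V] part, and the matrix part of an element that squares to 1 is trivial in
    odd characteristic. *)
Lemma heis_squares : (#|center_inv heis :&: squares heis| <= 1)%N.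
Proof.
rewrite -(cards1 (1%g : heis)); apply/subset_leq_card/fintype.subsetP => z.
case/setIP => /center_invP[_ zz] /imsetP[y _ zE]; rewrite inE; move: zz; rewrite zE => zz.
apply/negPn/negP => yy.
have [h|h] := boolP ((heis_a (y * y)%g != 0) || (heis_b (y * y)%g != 0) || (heis_c (y * y)%g != 0)).
  by move: (heis_sqr_neq1 h); rewrite zz eqxx.
move: h; rewrite !negb_or !negbK => /andP[/andP[/eqP ha /eqP hb] /eqP hc].
move/negP: yy; apply; apply/eqP.
apply: (congr2 (fun u w : _ => (u, w))) hc; apply: (congr2 (fun u w : _ => (u, w))) hb.
by apply: (congr2 (fun u w : _ => (u, w))) ha; exact: V2.
Qed.

Lemma card_heis_corner :
  (#|[set x : heis | (heis_a x == 0%R) && (heis_b x == 0%R)]%SET| <= #|V| * #|F|)%N.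
Proof.
pose f (y : heis) : V * F := (heis_v y, heis_c y).
have f_inj : {in [set x : heis | (heis_a x == 0) && (heis_b x == 0)]%SET &, injective f}.
  move=> [[[v a] b] c] [[[v' a'] b'] c']; rewrite !inE /heis_a /heis_b /=.
  move=> /andP[/eqP-> /eqP->] /andP[/eqP-> /eqP->].
  by rewrite /f /heis_v /heis_c /= => -[-> ->].
by rewrite -(card_in_imset f_inj); apply: leq_trans (max_card _) _; rewrite card_prod.
Qed.

Lemma card_heis_v :
  (#|[set x : heis | (heis_a x == 0%R) && (heis_b x == 0%R) && (heis_c x == 0%R)]%SET| <= #|V|)%N.
Proof.
pose f (y : heis) : V := heis_v y.
have f_inj : {in [set x : heis | (heis_a x == 0) && (heis_b x == 0) && (heis_c x == 0)]%SET &, injective f}.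
  move=> [[[v a] b] c] [[[v' a'] b'] c']; rewrite !inE /heis_a /heis_b /heis_c /=.
  move=> /andP[/andP[/eqP-> /eqP->] /eqP->] /andP[/andP[/eqP-> /eqP->] /eqP->].
  by rewrite /f /heis_v /= => ->.
by rewrite -(card_in_imset f_inj); exact: max_card.
Qed.

End Heisenberg.

(** * Thresholds between 1/4 and 1 *)

Section HeisenbergFamily.
Variable R : realType.
Local Open Scope classical_set_scope.
Local Open Scope ring_scope.

(** With [|V|] about [n^c] and [q^3] about [n^(1 - c)], the first moment splits into three classes:
    about [n^(1 - 4 a)] for elements off the matrix center, [n^(c + (1 - c) / 3 - 2 a)] for a
    nonzero corner entry, and [n^(c - a)] for [V]. For [a > c] the first two vanish because
    [c >= 1/4]; both become critical exactly at [c = 1/4]. *)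
Lemma heis_interval_realized (c : R) : 1 / 4 <= c <= 1 ->
  exists G : nat -> finGroupType,
    (#|G k| @[k --> \oo] --> \oo) /\ is_diam2_threshold G c.
Proof.
move=> /andP[c14 c1]; have c0 : 0 < c by lra.
(* A prime above [k + 2] is odd, and it tends to infinity with [k]. *)
pose q k := s2val (prime_above k.+2).
have qk k : (k.+2 < q k)%N by rewrite /q; case: (prime_above k.+2).
have q_pr k : prime (q k) by rewrite /q; case: (prime_above k.+2).
have qt k : (q k <= q k ^ 3)%N by rewrite -{1}[q k]expn1 leq_pexp2l // prime_gt0.
have tk k : (k < q k ^ 3)%N by have := qt k; have := qk k; clear; lia.
have b01 : 0 < c <= 1 by rewrite c0.
have [dim hdim] := dyadic_exponent tk b01.
pose V k : finZmodType := 'rV['F_2]_(dim k); pose F k : finFieldType := 'F_(q k).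
have V2 k (v : V k) : v + v = 0 by exact: rowF2_double.
have F2 k : (1 + 1 : F k) != 0.
  rewrite -[1 + 1]/(2%:R) -(dvdn_pcharf (pchar_Fp (q_pr k))).
  rewrite dvdn_prime2 //; apply/eqP => q2; have := qk k; rewrite q2; clear; lia.
pose G k : finGroupType := heis (V k) (F k); exists G.
have cV k : #|V k| = (2 ^ dim k)%N by rewrite card_mx card_Fp // mul1n.
have cF k : #|F k| = q k by exact: card_Fp.
have cG k : #|G k| = (2 ^ dim k * q k ^ 3)%N by rewrite card_heis cV cF.
have Glarge n0 : \forall k \near \oo, (n0 <= #|G k|)%N.
  exists n0 => // k /= hk; rewrite cG; apply: leq_trans hk (leq_trans (ltnW (tk k)) _).
  by rewrite leq_pmull // expn_gt0.
have Goo : #|G k| @[k --> \oo] --> \oo by apply/cvgnyPge.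
have q0 k : 0 < (q k)%:R :> R by rewrite ltr0n prime_gt0.
have lnG k : ln (#|G k|%:R) = (dim k)%:R * ln 2 + ln (q k ^ 3)%:R :> R.
  rewrite cG natrM lnM ?posrE ?ltr0n ?expn_gt0 ?prime_gt0 // natrX lnXn ?ltr0n //.
  by rewrite mulr_natl.
have close d : 0 < d -> \forall k \near \oo,
    `|(dim k)%:R * ln 2 - c * ln (#|G k|%:R)| <= d * ln (#|G k|%:R) :> R.
  by move=> d0; have [k0 h] := hdim d d0; exists k0 => // k /= /h; rewrite -lnG.
split=> //; apply: (@threshold_criterion R G _ 1) => // [k|a /andP[a0 ac]|a ac eta eta0].
- by apply: heis_squares => //; exact: V2.
- pose d := 1 / 2 * (c - a); have d0 : 0 < d by rewrite mulr_gt0 // subr_gt0.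
  exists d => //; near=> k.
  have : `|(dim k)%:R * ln 2 - c * ln (#|G k|%:R)| <= d * ln (#|G k|%:R) :> R.
    by near: k; exact: close.
  rewrite ler_norml => /andP[lo _].
  have L0 : 0 <= ln (#|G k|%:R) :> R.
    by rewrite ln_ge0 // ler1n -(ltr0n R) order_gt0.
  have lnZ : (dim k)%:R * ln 2 <= ln #|center_inv (G k)|%:R :> R.
    have Z : (#|V k| <= #|center_inv (G k)|)%N by apply: card_heis_center_ge; exact: V2.
    have Z0 : (0 < #|center_inv (G k)|)%N by apply: leq_trans Z; rewrite cV expn_gt0.
    by rewrite -ler_expR lnK ?posrE ?ltr0n // expRM_natl lnK ?posrE // -natrX ler_nat -cV.
  have : a * ln (#|G k|%:R) * (1 - #|sqrt1 (G k)|%:R / (2 * #|G k|%:R)) <=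
      a * ln (#|G k|%:R).
    rewrite -[leRHS]mulr1; apply: ler_wpM2l; first by rewrite mulr_ge0 // ltW.
    by rewrite gerBl divr_ge0 // mulr_ge0 ?ler0n.
  by move: lo lnZ; rewrite /d; clear; lra.
pose g := a - c; have g0 : 0 < g by rewrite subr_gt0.
have g4 : 0 < g / 4 by rewrite divr_gt0.
have eta3 : 0 < eta / 3 by rewrite divr_gt0.
have [n1 hn1] := expRN_ln_small g4 eta3.
have a0 : 0 < a by exact: lt_trans ac.
near=> k.
have nk1 : (n1 <= #|G k|)%N by near: k; exact: Glarge.
have aq : 8 * a / g <= (q k)%:R.
  apply: le_trans (ltW (truncnS_gt _)) _; rewrite ler_nat.
  apply: leq_trans (ltnW (qk k)); apply: leqW; rewrite ltnS.
  by near: k; exists (Num.truncn (8 * a / g)).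
have : `|(dim k)%:R * ln 2 - c * ln (#|G k|%:R)| <= g / 4 * ln (#|G k|%:R) :> R.
  by near: k; exact: close.
rewrite ler_norml => /andP[_ hi].
have small := hn1 _ nk1; have lnE := lnG k.
have n_ge1 : (0 < #|G k|)%N by rewrite -(ltr0n R) order_gt0.
have n_gt0 := order_gt0 R (G k).
have nE : #|G k|%:R = expR (ln (#|G k|%:R)) :> R by rewrite lnK ?posrE.
set n : R := #|G k|%:R in hi nE lnE small n_gt0 *; set L := ln n in hi nE lnE small *.
set Q : R := (q k)%:R in aq.
have Q0 : 0 < Q by exact: q0.
have L0 : 0 <= L by rewrite ln_ge0 // ler1n.
have aL0 : 0 <= a * L by rewrite mulr_ge0 // ltW.
have [u uE] : exists u : R, u = a * L / Q by eexists.
have uL : u <= g / 8 * L.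
  rewrite uE ler_pdivrMr //; move: aq; rewrite ler_pdivrMr // => aq.
  by have := ler_wpM2r L0 aq; clear; lra.
pose m : R := (#|V k| * #|F k| ^ 2)%:R.
have mQ : m * Q = n by rewrite /m /n /Q cG cV cF -natrM -mulnA -expnSr.
have m0 : 0 <= m by exact: ler0n.
pose e1 := expR (- (a * L * (4 - 16 / Q))).
pose e2 := expR (- (a * L * (2 - 2 / Q))).
pose e3 := expR (- (a * L * (1 - Q^-1))).
pose P2 := [set x : G k | (heis_a x == 0) && (heis_b x == 0)]%SET.
pose P3 := [set x : G k | (heis_a x == 0) && (heis_b x == 0) && (heis_c x == 0)]%SET.
have e1p : 0 <= e1 by exact: expR_ge0.
have e2p : 0 <= e2 by exact: expR_ge0.
have e3p : 0 <= e3 by exact: expR_ge0.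
(* Since [m / n = 1 / Q], each set of [m] exceptional [y] perturbs the ratio by a multiple of
   [1 / Q]; this is the source of the corrections in [e1], [e2] and [e3]. *)
have ratio (x : G k) (b d : R) : 2 * b * n <= (proddeg x)%:R + 2 * d * m ->
    b - d / Q <= (proddeg x)%:R / (2 * n).
  move=> h; rewrite ler_pdivlMr ?mulr_gt0 //.
  have -> : (b - d / Q) * (2 * n) = 2 * b * n - 2 * d * (n / Q) by field; rewrite gt_eqF.
  by rewrite -{2}mQ mulfK ?gt_eqF // lerBlDr.
have bound : \sum_(x : G k | x != 1%g) expR (- (a * L * ((proddeg x)%:R / (2 * n)))) <=
    n * e1 + #|P2|%:R * e2 + #|P3|%:R * e3.
  have -> : n * e1 = \sum_(x : G k) e1 by rewrite sumr_const -[RHS]mulr_natl.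
  have -> : #|P2|%:R * e2 = \sum_(x in P2) e2 by rewrite sumr_const -[RHS]mulr_natl.
  have -> : #|P3|%:R * e3 = \sum_(x in P3) e3 by rewrite sumr_const -[RHS]mulr_natl.
  rewrite [X in _ <= _ + X + _]big_mkcond [X in _ <= _ + X]big_mkcond -!big_split /=.
  rewrite [leLHS]big_mkcond /=; apply: ler_sum => x _.
  have p2 : 0 <= (if x \in P2 then e2 else 0) by case: ifP.
  have p3 : 0 <= (if x \in P3 then e3 else 0) by case: ifP.
  case: ifP => _; last by rewrite !addr_ge0.
  have [ab|ab] := boolP ((heis_a x != 0) || (heis_b x != 0)).
    apply: (@le_trans _ _ e1); last by rewrite -addrA lerDl addr_ge0.
    rewrite ler_expR lerN2; apply: ler_wpM2l => //; apply: ratio.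
    have := proddeg_heis_noncentral (F2 k) ab; rewrite -/(G k) => h.
    have {}h : (8 * #|G k| <= proddeg x + 32 * (#|V k| * #|F k| ^ 2))%N.
      by move: h; rewrite mulnBr leq_subLR mulnA addnC.
    by move: h; rewrite -(ler_nat R) natrD 2!natrM -/n -/m; clear; lra.
  have xP2 : x \in P2 by rewrite inE; move: ab; rewrite negb_or !negbK.
  have /andP[/eqP xa _] : (heis_a x == 0) && (heis_b x == 0) by move: xP2; rewrite inE.
  have [xc|xc] := boolP (heis_c x != 0).
    rewrite xP2; apply: (@le_trans _ _ e2); last by rewrite addrAC lerDr addr_ge0.
    rewrite ler_expR lerN2; apply: ler_wpM2l => //; apply: ratio.
    have := proddeg_heis_corner (F2 k) xa xc; rewrite -/(G k) => h.
    have {}h : (4 * #|G k| <= proddeg x + 4 * (#|V k| * #|F k| ^ 2))%N.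
      by move: h; rewrite mulnBr leq_subLR addnC.
    by move: h; rewrite -(ler_nat R) natrD 2!natrM -/n -/m; clear; lra.
  have xP3 : x \in P3 by move: xP2; rewrite !inE => ->; move: xc; rewrite negbK.
  rewrite xP3; apply: (@le_trans _ _ e3); last by rewrite lerDr addr_ge0.
  rewrite ler_expR lerN2; apply: ler_wpM2l => //; rewrite -[Q^-1]mul1r; apply: ratio.
  have := proddeg_heis_ge (F2 k) x; rewrite -/(G k) => h.
  have {}h : (2 * #|G k| <= proddeg x + 2 * (#|V k| * #|F k| ^ 2))%N.
    by move: h; rewrite mulnBr leq_subLR addnC.
  by move: h; rewrite -(ler_nat R) natrD 2!natrM -/n -/m; clear; lra.
apply: (le_trans bound).
set v : R := (dim k)%:R * ln 2 in hi lnE.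
have VE : #|V k|%:R = expR v by rewrite cV natrX /v expRM_natl lnK ?posrE.
have lnQ : ln (q k ^ 3)%:R = 3 * ln Q :> R by rewrite natrX lnXn // mulr_natl.
have QE : Q = expR (ln Q) by rewrite lnK ?posrE.
have cP2 : #|P2|%:R <= expR (v + ln Q).
  rewrite expRD -VE -QE /Q -natrM ler_nat -(cF k); exact: card_heis_corner.
have cP3 : #|P3|%:R <= expR v by rewrite -VE ler_nat; exact: card_heis_v.
have b1 : n * e1 <= expR (- (g / 4 * L)).
  rewrite nE -expRD ler_expR.
  have -> : a * L * (4 - 16 / Q) = 4 * (a * L) - 16 * u by rewrite uE; field; rewrite gt_eqF.
  have := ler_wpM2r L0 c14; have : 0 <= g * L by rewrite mulr_ge0 // ltW.
  by move: uL; rewrite /g; clear; lra.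
have b2 : #|P2|%:R * e2 <= expR (- (g / 4 * L)).
  apply: le_trans (ler_wpM2r e2p cP2) _; rewrite -expRD ler_expR.
  have -> : a * L * (2 - 2 / Q) = 2 * (a * L) - 2 * u by rewrite uE; field; rewrite gt_eqF.
  have := ler_wpM2r L0 c14; have : 0 <= g * L by rewrite mulr_ge0 // ltW.
  by move: uL hi lnE; rewrite lnQ /g; clear; lra.
have b3 : #|P3|%:R * e3 <= expR (- (g / 4 * L)).
  apply: le_trans (ler_wpM2r e3p cP3) _; rewrite -expRD ler_expR.
  have -> : a * L * (1 - Q^-1) = a * L - u by rewrite uE; field; rewrite gt_eqF.
  have : 0 <= g * L by rewrite mulr_ge0 // ltW.
  by move: uL hi; rewrite /g; clear; lra.
by move: b1 b2 b3 small; clear; lra.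
Unshelve. all: by end_near.
Qed.

End HeisenbergFamily.

Local Open Scope classical_set_scope.
Local Open Scope ring_scope.

Theorem theorem1p1 (R : realType) (c : R) (hc : 1 / 4 <= c <= 2) :
  (exists G : nat -> finGroupType,
      (#|G k| @[k --> \oo] --> \oo) /\ is_diam2_threshold G c)
  <->
  (1 / 4 <= c <= 4 / 3 \/
   exists n : nat, (0 < n)%N /\ c = 4 * n%:R / (3 * n%:R - 1)).
Proof.
case/andP: hc => c14 c2; split=> [[G [Goo thr]]|[/andP[_ c43]|[n [n0 ->]]]].
- have [c43|c43] := leP c (4 / 3); [by left; rewrite c14|right].
  exact: threshold_necessary Goo thr c43 c2.
- have [c1|c1] := leP c 1.
    by apply: heis_interval_realized; rewrite c14.
  by apply: dih_interval_realized; rewrite (ltW c1).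
- exact: crat_realized.
Qed.
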